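(* Let $n\in\mathbb{N}$ and let $T(a,b,c)$ be an $(n+1)$-periodic tridiagonal operator acting on $\ell^2(\mathbb{N}_0)$. Then there exists a $2(n+1)\times 2(n+1)$ complex matrix $A$ such that \[ \overline{W(T(a,b,c))}=W(A), \] where the matrix $A$ is chosen so that its Kippenhahn polynomial $F_A$ satisfies \[ F_A(t,x,y)=\left(G_n(t,x,y)-|\alpha_n x+\gamma_n y|^2 H_n(t,x,y)\right)^2-4\prod_{j=0}^{n}\left|\alpha_j x+\gamma_j y\right|^2 . \]
   Context: $\mathbb{N}$ is the set of positive integers and $\mathbb{N}_0$ the set of nonnegative integers. Let $n\in\mathbb{N}$ and let $a=(a_j)_{j\ge 0}$, $b=(b_j)_{j\ge0}$, $c=(c_j)_{j\ge0}$ be $(n+1)$-periodic sequences of complex numbers (i.e. $a_{j+n+1}=a_j$, etc., for all $j\geq 0$). The $(n+1)$-periodic tridiagonal operator $T=T(a,b,c)$ is the bounded operator on $\ell^2(\mathbb{N}_0)$ whose matrix (rows and columns indexed by $\mathbb{N}_0$) has entries $T_{j,j}=b_j$, $T_{j,j+1}=c_j$, $T_{j+1,j}=a_{j+1}$ for $j\ge 0$, and all other entries $0$. For a bounded operator $A$ on a Hilbert space, $W(A)=\{\langle Ax,x\rangle : \|x\|=1\}$ is its numerical range. For a square matrix $A$, $\mathrm{Re}(A)=\frac12(A+A^* )$, $\mathrm{Im}(A)=\frac1{2i}(A-A^* )$, and for an $m\times m$ matrix $A$ the Kippenhahn polynomial is $F_A(t,x,y)=\det(tI_m+x\,\mathrm{Re}(A)+y\,\mathrm{Im}(A))$.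 The variables $t,x,y$ are real, so $|\alpha x+\gamma y|^2=(\alpha x+\gamma y)(\overline{\alpha}x+\overline{\gamma}y)$ is a real quadratic form in $x,y$ for $\alpha,\gamma\in\mathbb{C}$. For $0\le j<n$ put $\alpha_j=\frac{c_j+\overline{a_{j+1}}}{2}$, $\gamma_j=\frac{c_j-\overline{a_{j+1}}}{2i}$, and put $\alpha_n=\frac{a_0+\overline{c_n}}{2}$, $\gamma_n=\frac{a_0-\overline{c_n}}{2i}$. Set $\lambda_{j,j}=t+\mathrm{Re}(b_{j-1})x+\mathrm{Im}(b_{j-1})y$ for $1\le j\le n+1$, and $\lambda_{j,j+1}=\alpha_{j-1}x+\gamma_{j-1}y$, $\lambda_{j+1,j}=\overline{\alpha_{j-1}}x+\overline{\gamma_{j-1}}y$ for $1\le j\le n$. Then $G_n(t,x,y)$ is the determinant of the $(n+1)\times(n+1)$ tridiagonal matrix whose $(i,j)$ entry is $\lambda_{i,j}$ if $|i-j|\le 1$ and $0$ otherwise ($1\le i,j\le n+1$). For $n=1$, $H_1(t,x,y)=1$; for $n\ge2$, $H_n(t,x,y)$ is the determinant of the $(n-1)\times(n-1)$ tridiagonal matrix obtained from the previous one by keeping only rows and columns $2,\dots,n$. *)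

(* Defs.v *)
From HB Require Import structures.
From mathcomp Require Import all_boot all_order all_algebra.
From mathcomp Require Import all_classical all_reals all_analysis.
From mathcomp Require Import complex spectral.

Set Implicit Arguments.
Unset Strict Implicit.
Unset Printing Implicit Defensive.

Import Order.TTheory GRing.Theory Num.Theory.
Import numFieldNormedType.Exports.

Local Open Scope classical_set_scope.
Local Open Scope complex_scope.
Local Open Scope sesquilinear_scope.
Local Open Scope ring_scope.

Section NumericalRange.
Variable R : realType.

(* The inner product space is the subset D of V, with inner product dot,
   linear in its first argument. *)
Definition numrange (V : Type) (D : set V) (dot : V -> V -> R[i])
    (A : V -> V) : set R[i] :=
  [set dot (A x) x | x in [set x | D x /\ sqrtC (dot x x) = 1]].

Definition ell2 : set (nat -> R[i]) :=
  [set x | cvgn (series (fun j => ComplexField.Normc.normc (x j) ^+ 2))].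

(* R[i]^o carries the topology induced by the modulus; the series converges for
   u and v in ell2. *)
Definition ell2_dot (u v : nat -> R[i]) : R[i] :=
  limn (series (fun j => u j * (v j)^* : R[i]^o)).

Definition numrange_ell2 := numrange ell2 ell2_dot.

Definition cvec_dot m (u v : 'cV[R[i]]_m) : R[i] := (v ^t* *m u) 0 0.

Definition numrange_mx m (A : 'M[R[i]]_m) : set R[i] :=
  numrange setT (@cvec_dot m) (mulmx A).

End NumericalRange.

Section Tridiagonal.
Variables (R : realType) (a b c : nat -> R[i]).

Definition tridiag_entry (j k : nat) : R[i] :=
  if k == j then b j
  else if k == j.+1 then c j
  else if j == k.+1 then a j
  else 0.

(* Row j of the matrix vanishes beyond column j + 1, so the finite sum is the
   whole matrix-vector product. *)
Definition tridiag_op (x : nat -> R[i]) : nat -> R[i] :=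
  fun j => \sum_(k < j.+2) tridiag_entry j k * x k.

End Tridiagonal.

Section Kippenhahn.
Variables (R : realType) (m : nat).
Implicit Type A : 'M[R[i]]_m.

Definition Remx A := 2^-1 *: (A + A ^t*).
Definition Immx A := (2 * 'i)^-1 *: (A - A ^t*).

Definition kippenhahn A (t x y : R) : R[i] :=
  \det ((t%:C)%:M + x%:C *: Remx A + y%:C *: Immx A).

End Kippenhahn.

Section GH.
Variables (R : realType) (n : nat) (a b c : nat -> R[i]).

(* Used for j <= n only. *)
Definition alpha_coef (j : nat) : R[i] :=
  if (j < n)%N then (c j + (a j.+1)^*) / 2 else (a 0 + (c n)^*) / 2.

Definition gamma_coef (j : nat) : R[i] :=
  if (j < n)%N then (c j - (a j.+1)^*) / (2 * 'i)
  else (a 0 - (c n)^*) / (2 * 'i).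

(* Indices start at 0: lambda_entry t x y i j is lambda_{i+1,j+1}. *)
Definition lambda_entry (t x y : R) (i j : nat) : R[i] :=
  if i == j then t%:C + 'Re (b i) * x%:C + 'Im (b i) * y%:C
  else if j == i.+1 then alpha_coef i * x%:C + gamma_coef i * y%:C
  else if i == j.+1 then (alpha_coef j)^* * x%:C + (gamma_coef j)^* * y%:C
  else 0.

Definition G_poly (t x y : R) : R[i] :=
  \det (\matrix_(i < n.+1, j < n.+1) lambda_entry t x y i j).

(* Rows and columns 1, ..., n - 1 counted from 0; for n = 1 this is the
   determinant of the empty matrix, that is 1. *)
Definition H_poly (t x y : R) : R[i] :=
  \det (\matrix_(i < n.-1, j < n.-1) lambda_entry t x y i.+1 j.+1).

End GH.

(* Main.v *)
(** In a direction [zeta] the real part of [zeta * <Tu, u>] only involves the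
    moduli of the entries of [u] and of the edges [l_j = zeta c_j +
    conj (zeta a_(j+1))], up to phases that can be gauged away along a path. The
    matrix [A] is the tridiagonal matrix closed up into a cycle of length
    [2(n+1)] that runs through one period of [T] and then through a second one
    with the two entries of each edge exchanged: this conjugates the edges of the
    second half, so the phases around the cycle cancel for every [zeta].
    Folding a finitely supported vector modulo [2(n+1)] (Cauchy-Schwarz) and
    repeating a vector of the cycle many times along the half-line show that both
    numerical ranges have the same support function. Both are convex: the one
    of [A] by Toeplitz-Hausdorff, the one of [T] because finitely supported
    vectors can be translated apart; and the one of [A] is closed.
    The determinant of the pencil of [A] is [tr (tau ^ 2) - 2 det tau], where
    [tau] is the transfer matrix of one period, and [tr tau] is
    [G_n - |alpha_n x + gamma_n y|^2 H_n], [det tau] the product of the squared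
    moduli of the edges. *)
Require Import Defs.
From mathcomp Require Import all_boot all_order all_algebra.
From mathcomp Require Import all_classical all_reals all_analysis.
From mathcomp Require Import complex.
From mathcomp Require Import ring lra zify.

Set Implicit Arguments.
Unset Strict Implicit.
Unset Printing Implicit Defensive.

Import Order.TTheory GRing.Theory Num.Theory.
Import numFieldNormedType.Exports.
Import ComplexField.Normc.

Local Open Scope classical_set_scope.
Local Open Scope complex_scope.
Local Open Scope ring_scope.

(** * Continuants and determinants of cyclic tridiagonal matrices *)

Section Continuants.
Variable F : comNzRingType.
Implicit Types (d up dn w : nat -> F).

(** The cofactors along row [i] do not see that row, so the expansion along it is affine in the
    changed entry. *)
Lemma det_add_delta_mx n (A : 'M[F]_n) (i j : 'I_n) (x : F) :
  \det (A + x *: delta_mx i j) = \det A + x * cofactor A i j.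
Proof.
have cofE (k : 'I_n) : cofactor (A + x *: delta_mx i j) i k = cofactor A i k.
  rewrite /cofactor; congr (_ * \det _); apply/matrixP => r s.
  by rewrite !mxE eq_sym (negPf (neq_lift _ _)) /= mulr0 addr0.
rewrite (expand_det_row _ i) (expand_det_row A i).
under eq_bigr => k _ do rewrite cofE !mxE eqxx mulrDl.
rewrite big_split /=; congr (_ + _).
rewrite (bigD1 j) //= eqxx mulr1 big1 ?addr0 // => k /negPf ->.
by rewrite mulr0 mul0r.
Qed.

Definition tridiag_mx d up dn k : 'M[F]_k :=
  \matrix_(i < k, j < k)
    if i == j :> nat then d i
    else if j == i.+1 :> nat then up i
    else if i == j.+1 :> nat then dn j
    else 0.

(** The principal minor of a tridiagonal matrix on the indices [s, ..., s + k - 1]. The off-diagonal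
    entries enter only through the products [w i] across the edges from [i] to [i + 1]. *)
Fixpoint continuant d w s k : F :=
  match k with
  | 0 => 1
  | k1.+1 => d s * continuant d w s.+1 k1 -
             (if k1 is k2.+1 then w s * continuant d w s.+2 k2 else 0)
  end.

Arguments continuant : simpl never.

Lemma continuant0 d w s : continuant d w s 0 = 1.
Proof. by []. Qed.

Lemma continuant1 d w s : continuant d w s 1 = d s.
Proof. by rewrite /continuant mulr1 subr0. Qed.

Lemma continuant2 d w s k :
  continuant d w s k.+2 =
    d s * continuant d w s.+1 k.+1 - w s * continuant d w s.+2 k.
Proof. by []. Qed.

Lemma det_tridiag_mx d up dn s k :
  \det (tridiag_mx (fun i => d (i + s)%N) (fun i => up (i + s)%N)
                   (fun i => dn (i + s)%N) k) =
  continuant d (fun i => up i * dn i) s k.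
Proof.
(* The recurrence reaches back two sizes, so two consecutive sizes are carried through the
   induction. *)
suff [] : \det (tridiag_mx (fun i => d (i + s)%N) (fun i => up (i + s)%N)
                   (fun i => dn (i + s)%N) k) =
  continuant d (fun i => up i * dn i) s k /\
  \det (tridiag_mx (fun i => d (i + s)%N) (fun i => up (i + s)%N)
                   (fun i => dn (i + s)%N) k.+1) =
  continuant d (fun i => up i * dn i) s k.+1 by [].
elim: k s => [|k IH] s.
  by rewrite det_mx00 det_mx11 !mxE /= /continuant mulr1 subr0.
split; first by case: (IH s).
rewrite continuant2 (expand_det_row _ ord0) !big_ord_recl big1 ?addr0; last first.
  by move=> i _; rewrite !mxE /= mul0r.
rewrite !mxE /= /cofactor /= add0n expr0 expr1 !mul1r; congr (_ + _).
  congr (_ * _); case: (IH s.+1) => _ <-; congr (\det _).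
  by apply/matrixP => i j; rewrite !mxE /= /bump !add1n !addSnnS !eqSS.
rewrite mulN1r mulrN -mulrA; congr (- (_ * _)).
rewrite (expand_det_col _ ord0) big_ord_recl big1 ?addr0; last first.
  by move=> i _; rewrite !mxE /= mul0r.
rewrite !mxE /= /cofactor /= expr0 mul1r; congr (_ * _).
case: (IH s.+2) => <- _; congr (\det _).
by apply/matrixP => i j; rewrite !mxE /= /bump !add1n !addSnnS !eqSS.
Qed.

(* The last row and column carry the corner entries that close the path of
   length [k.+2] into a cycle. *)
Lemma det_cyclic_tridiag_mx d up dn (p q : F) k :
  \det (tridiag_mx d up dn k.+2 + q *: delta_mx ord0 ord_max
        + p *: delta_mx ord_max ord0) =
  continuant d (fun i => up i * dn i) 0 k.+2
  - p * q * continuant d (fun i => up i * dn i) 1 k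
  + (-1) ^+ k.+1 * (q * \prod_(i < k.+1) dn i + p * \prod_(i < k.+1) up i).
Proof.
rewrite !det_add_delta_mx.
have -> : \det (tridiag_mx d up dn k.+2) = continuant d (fun i => up i * dn i) 0 k.+2.
  rewrite -det_tridiag_mx; congr (\det _).
  by apply/matrixP => i j; rewrite !mxE !addn0.
have bmp m (i : 'I_m) : bump m i = i by rewrite /bump leqNgt ltn_ord.
rewrite /cofactor /= addn0 add0n.
set X := row' ord0 _; set Y := row' ord_max _.
(* Without the first row and the last column the subdiagonal becomes the diagonal of an upper
   triangular matrix. *)
have -> : \det X = \prod_(i < k.+1) dn i.
  rewrite -det_tr det_trig.
    apply: eq_bigr => i _; rewrite !mxE /= bmp /bump /= add1n.
    by rewrite (gtn_eqF (leqnn i.+1)) (ltn_eqF (leqW (leqnn i.+1))) eqxx.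
  apply/is_trig_mxP => i j ij; rewrite !mxE /= bmp /bump /= add1n.
    case: i j ij => [i ?] [j ?] /= ij.
  by do 3 (case: eqP => [?|_]; first by exfalso; lia).
(* This minor is lower triangular except for the surviving corner [q], whose cofactor is the
   continuant of the inner path. *)
pose Y0 := row' ord_max (col' ord0 (tridiag_mx d up dn k.+2)).
have -> : Y = Y0 + q *: delta_mx ord0 ord_max.
  apply/matrixP => i j; rewrite !mxE /=; congr (_ + q * _).
  rewrite -!(inj_eq val_inj) /= bmp /bump /= add1n.
  by rewrite eqSS.
have -> : \det (Y0 + q *: delta_mx ord0 ord_max) =
    \prod_(i < k.+1) up i + q * (-1) ^+ k * continuant d (fun i => up i * dn i) 1 k.
  rewrite det_add_delta_mx det_trig; last first.
    apply/is_trig_mxP => i j ij; rewrite !mxE /= bmp /bump /= add1n.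
    case: i j ij => [i ?] [j ?] /= ij.
    by do 3 (case: eqP => [?|_]; first by exfalso; lia).
  rewrite /cofactor /= add0n -mulrA -det_tridiag_mx; congr (_ + _).
    apply: eq_bigr => i _; rewrite !mxE /= bmp /bump /= add1n eqxx.
    by case: eqP => // /eqP; rewrite (ltn_eqF (leqnn i.+1)).
  congr (q * (_ * @determinant F k _)).
  apply/matrixP => i j; rewrite !mxE /= !bmp /bump /= !add1n !addn1 !eqSS.
  by rewrite [(k < i.+1)%N]ltnNge ltn_ord add0n !eqSS.
have sgn2 : (-1) ^+ k.+1 * (-1) ^+ k = -1 :> F.
  by rewrite -exprD addSn exprS addnn -mul2n exprM sqrrN !expr1n mulr1.
by ring: sgn2.
Qed.

(** Euler's rule: a term of the determinant either avoids the edge between [s + k] and [s + k + 1],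
    or uses it and thereby removes both of its ends. *)
Lemma continuantD d w s k l :
  continuant d w s (k.+1 + l.+1) =
    continuant d w s k.+1 * continuant d w (s + k.+1) l.+1
    - w (s + k)%N * continuant d w s k * continuant d w (s + k.+2) l.
Proof.
suff [] : continuant d w s (k.+1 + l.+1) =
    continuant d w s k.+1 * continuant d w (s + k.+1) l.+1
    - w (s + k)%N * continuant d w s k * continuant d w (s + k.+2) l /\
  continuant d w s (k.+2 + l.+1) =
    continuant d w s k.+2 * continuant d w (s + k.+2) l.+1
    - w (s + k.+1)%N * continuant d w s k.+1 * continuant d w (s + k.+3) l by [].
elim: k s => [|k IH] s.
  rewrite !addSn !add0n !continuant2 !(addnS s) !addn0.
  by rewrite !continuant1 !continuant0; split; ring.
split; first by case: (IH s).
have [_ E1] := IH s.+1; have [E2 _] := IH s.+2.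
rewrite [LHS](continuant2 d w s (k.+1 + l.+1)) E1 E2 !(continuant2 _ _ s).
by rewrite !addSn !addnS; ring.
Qed.

(** A Casorati determinant of two solutions of the three-term recurrence; each step of the
    recurrence multiplies it by one [w]. *)
Lemma continuant_casorati d w s k :
  continuant d w s k.+1 * continuant d w s.+1 k.+1
  - continuant d w s k.+2 * continuant d w s.+1 k = \prod_(i < k.+1) w (s + i)%N.
Proof.
elim: k s => [|k IH] s.
  by rewrite big_ord1 addn0 continuant2 !continuant1 !continuant0; ring.
rewrite big_ord_recl addn0; under eq_bigr => i _ do rewrite -addSnnS.
rewrite -IH !(continuant2 _ _ s).
by ring.
Qed.

Lemma continuant_shift d w p s k :
  (forall i, d (i + p)%N = d i) -> (forall i, w (i + p)%N = w i) ->
  continuant d w (s + p) k = continuant d w s k.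
Proof.
move=> dp wp.
suff [] : continuant d w (s + p) k = continuant d w s k /\
  continuant d w (s + p) k.+1 = continuant d w s k.+1 by [].
elim: k s => [|k IH] s; first by rewrite !continuant1 dp.
split; first by case: (IH s).
rewrite !continuant2 dp wp -!addSn.
by have [_ ->] := IH s.+1; have [-> _] := IH s.+2.
Qed.

(* With [tau] the transfer matrix over one period, the left-hand side is
   [tr (tau ^+ 2)], the squared factor is [tr tau] and the product is [det tau]. *)
Lemma continuant_double d w m :
  (forall i, d (i + m.+2)%N = d i) -> (forall i, w (i + m.+2)%N = w i) ->
  continuant d w 0 (m.+2 + m.+2) - w m.+1 * continuant d w 1 (m.+1 + m.+1) =
  (continuant d w 0 m.+2 - w m.+1 * continuant d w 1 m) ^+ 2
  - 2 * \prod_(i < m.+2) w i.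
Proof.
move=> dp wp.
have sh s k : continuant d w (s + m.+2) k = continuant d w s k.
  exact: continuant_shift.
(* Both windows are cut at the period and moved back into the first one; the Casorati identity then
   supplies the product. *)
rewrite (continuantD d w 0 m.+1 m.+1) (continuantD d w 1 m m).
have -> : (1 + m.+1 = 0 + m.+2)%N by [].
rewrite !sh !add0n add1n (sh 1%N).
rewrite big_ord_recr /=.
have := continuant_casorati d w 0 m.
rewrite !(continuant2 _ _ 0) => <-; ring.
Qed.
End Continuants.

(** * Quadratic forms along a path or a cycle *)

Section ComplexModulus.
Variable R : realType.
Implicit Types z w : R[i].

Lemma normc_ge0 z : 0 <= normc z.
Proof. by case: z => x y; rewrite sqrtr_ge0. Qed.

Lemma sqr_normcE z : normc z ^+ 2 = complex.Re z ^+ 2 + complex.Im z ^+ 2.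
Proof. by case: z => x y /=; rewrite sqr_sqrtr ?addr_ge0 ?sqr_ge0. Qed.

Lemma conjC_real (x : R) : (x%:C : R[i])^* = x%:C.
Proof. exact: conjc_real. Qed.

Lemma mulcJ z : z * z^* = (normc z ^+ 2)%:C.
Proof. by rewrite -normCK normc_def sqr_normcE -rmorphXn /= sqr_sqrtr ?addr_ge0 ?sqr_ge0. Qed.

Lemma Re_le_normc z : complex.Re z <= normc z.
Proof.
case: z => x y /=; apply: le_trans (ler_norm _) _.
by rewrite -sqrtr_sqr ler_sqrt ?addr_ge0 ?sqr_ge0 // lerDl sqr_ge0.
Qed.

Lemma normc_conj z : normc z^* = normc z.
Proof. by case: z => x y /=; rewrite sqrrN. Qed.

Lemma normc_real (x : R) : normc x%:C = `|x|.
Proof. by rewrite /= expr0n addr0 sqrtr_sqr. Qed.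

Lemma ReD z w : complex.Re (z + w) = complex.Re z + complex.Re w.
Proof. by case: z; case: w. Qed.

Lemma Re_realM (x : R) z : complex.Re (x%:C * z) = x * complex.Re z.
Proof. by case: z => a b /=; rewrite mul0r subr0. Qed.

Lemma real_complexD (x y : R) : (x + y)%:C = x%:C + y%:C :> R[i].
Proof. exact: rmorphD. Qed.

Lemma real_complexM (x y : R) : (x * y)%:C = x%:C * y%:C :> R[i].
Proof. exact: rmorphM. Qed.

Lemma Re_sum (I : Type) (s : seq I) (P : pred I) (F : I -> R[i]) :
  complex.Re (\sum_(i <- s | P i) F i) = \sum_(i <- s | P i) complex.Re (F i).
Proof. exact: (big_morph _ (@ReD) (erefl _)). Qed.

(* The junk value at 0 is 1, so that [phase] is unimodular everywhere. *)
Definition phase z : R[i] := if z == 0 then 1 else z / (normc z)%:C.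

Lemma normc_eq0 z : (normc z == 0) = (z == 0).
Proof.
by apply/eqP/eqP => [/eq0_normc //|->]; rewrite normc0.
Qed.

Lemma phase_unit z : phase z * (phase z)^* = 1.
Proof.
rewrite mulcJ /phase; case: eqVneq => [_|z0]; first by rewrite normc1 expr1n.
rewrite normcM normcV normc_real ger0_norm ?normc_ge0 // divff ?expr1n //.
by rewrite normc_eq0.
Qed.

Lemma phase_conj z : phase z^* = (phase z)^*.
Proof.
rewrite /phase conjC_eq0; case: eqP => [_|_]; first by rewrite rmorph1.
by rewrite rmorphM fmorphV /= normc_conj conjC_real.
Qed.

Lemma mul_phase z : z * (phase z)^* = (normc z)%:C.
Proof.
rewrite /phase; case: eqVneq => [->|z0]; first by rewrite mul0r normc0.
rewrite rmorphM fmorphV /= conjC_real mulrA mulcJ.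
by rewrite rmorphXn /= expr2 mulfK // eq_complex /= normc_eq0 (negPf z0).
Qed.

End ComplexModulus.

Section BandForms.
Variable R : realType.
Implicit Types (b up dn u l : nat -> R[i]) (h m r : nat -> R).

(* The quadratic form of the tridiagonal matrix with superdiagonal [up] and
   subdiagonal [dn], edges [(j, j+1)] being attached to the index [j]. *)
Definition band_form b up dn u K : R[i] :=
  \sum_(0 <= j < K) (b j * (u j * (u j)^*) + up j * (u j.+1 * (u j)^*)
              + dn j * (u j * (u j.+1)^*)).

Definition real_form h m r K : R :=
  \sum_(0 <= j < K) (h j * r j ^+ 2 + m j * (r j.+1 * r j)).

(** Under the real part the two cross terms of an edge merge, one being conjugated: this is twice
    the off-diagonal entry of the Hermitian part of [zeta] times the matrix. *)
Definition edge zeta up dn j : R[i] := zeta * up j + (zeta * dn j)^*.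

Lemma Re_band_form zeta b up dn u K :
  complex.Re (zeta * band_form b up dn u K) =
  \sum_(0 <= j < K) (complex.Re (zeta * b j) * normc (u j) ^+ 2
              + complex.Re (edge zeta up dn j * (u j.+1 * (u j)^*))).
Proof.
rewrite mulr_sumr Re_sum; apply: eq_bigr => j _.
rewrite mulcJ /edge; move: (normc (u j)) => s.
case: (u j) => u1 u2; case: (u j.+1) => v1 v2; case: (b j) => b1 b2.
case: (up j) => p1 p2; case: (dn j) => q1 q2; case: zeta => z1 z2 /=.
ring.
Qed.

Definition rot zeta b j : R := complex.Re (zeta * b j).

Definition edge_norm zeta up dn j : R := normc (edge zeta up dn j).

Lemma Re_band_form_le zeta b up dn u K :
  complex.Re (zeta * band_form b up dn u K) <=
  real_form (rot zeta b) (edge_norm zeta up dn) (fun j => normc (u j)) K.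
Proof.
rewrite Re_band_form; apply: ler_sum => j _; rewrite lerD2l.
by apply: le_trans (Re_le_normc _) _; rewrite !normcM normc_conj.
Qed.

(** The phase accumulated along a path; giving it to the entries of a nonnegative vector turns every
    edge [l i] into its modulus. *)
Definition gauge l j : R[i] := \prod_(0 <= i < j) (phase (l i))^*.

Lemma gaugeS l j : gauge l j.+1 = gauge l j * (phase (l j))^*.
Proof. by rewrite /gauge big_nat_recr. Qed.

Lemma gauge_unit l j : gauge l j * (gauge l j)^* = 1.
Proof.
elim: j => [|j IH]; first by rewrite /gauge big_geq // rmorph1 mulr1.
by rewrite gaugeS rmorphM mulrACA IH mul1r -rmorphM phase_unit rmorph1.
Qed.

Lemma normc_gauge l j : normc (gauge l j) = 1.
Proof.
apply/eqP; rewrite -(eqrXn2 (ltn0Sn 1)) ?normc_ge0 // expr1n.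
by have := gauge_unit l j; rewrite mulcJ => /complexI ->.
Qed.

(** Each phase of the first half meets its conjugate in the second half. *)
Lemma gauge_double l N :
  (forall k, (k < N)%N -> l (N + k)%N = (l k)^*) -> gauge l (N + N) = 1.
Proof.
move=> lN; rewrite /gauge (big_cat_nat (n := N)) ?leq_addr //=.
rewrite -{2}[N]add0n big_addn addnK -big_split /= big_nat big1 // => k /andP[_ kN].
by rewrite addnC lN // phase_conj conjCK mulrC phase_unit.
Qed.

(** The equality case of [Re_band_form_le]: the quotient of consecutive gauges cancels the phase of
    the edge between them. *)
Lemma Re_band_form_gauge zeta b up dn r K : (forall j, 0 <= r j) ->
  complex.Re (zeta * band_form b up dn
     (fun j => (r j)%:C * gauge (edge zeta up dn) j) K) =
  real_form (rot zeta b) (edge_norm zeta up dn) r K.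
Proof.
move=> r0; rewrite Re_band_form; apply: eq_bigr => j _; congr (_ + _).
  by rewrite normcM normc_gauge mulr1 normc_real ger0_norm.
rewrite rmorphM /= conjC_real gaugeS.
set l := edge _ _ _ _; set g := gauge _ _.
have -> : l * ((r j.+1)%:C * (g * (phase l)^*) * ((r j)%:C * g^*)) =
          (r j.+1 * r j)%:C * (l * (phase l)^*) * (g * g^*).
  by rewrite rmorphM /=; ring.
by rewrite gauge_unit mulr1 Re_realM mul_phase /= mulrC.
Qed.

Lemma band_form_eq b up dn u v K :
  (forall j, (j <= K)%N -> u j = v j) ->
  band_form b up dn u K = band_form b up dn v K.
Proof.
by move=> uv; apply: eq_big_nat => j /andP[_ jK]; rewrite !uv // ltnW.
Qed.

Lemma real_form_eq h m r s K :
  (forall j, (j <= K)%N -> r j = s j) -> real_form h m r K = real_form h m s K.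
Proof.
by move=> rs; apply: eq_big_nat => j /andP[_ jK]; rewrite !rs // ltnW.
Qed.

End BandForms.

(** * Folding a vector modulo the period *)

Section Folding.
Variable R : realType.
Implicit Types (h m r : nat -> R).

Lemma sum_fold (V : nmodType) (F : nat -> V) p M :
  \sum_(0 <= j < p * M) F j =
  \sum_(0 <= k < M) \sum_(0 <= i < p) F (k + i * M)%N.
Proof.
rewrite big_nat_mul exchange_big_nat /=; apply: eq_bigr => i _.
by rewrite -{1}[(i * M)%N]add0n big_addn mulSn addnK.
Qed.

Lemma sum_mul_le_sqrt (I : Type) (t : seq I) (f g : I -> R) :
  \sum_(i <- t) f i * g i <=
  Num.sqrt (\sum_(i <- t) f i ^+ 2) * Num.sqrt (\sum_(i <- t) g i ^+ 2).
Proof.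
have sq0 k : 0 <= \sum_(i <- t) k i ^+ 2 :> R by apply: sumr_ge0 => i _; exact: sqr_ge0.
set a := Num.sqrt _; set b := Num.sqrt _.
have a2 : a ^+ 2 = \sum_(i <- t) f i ^+ 2 by rewrite sqr_sqrtr.
have b2 : b ^+ 2 = \sum_(i <- t) g i ^+ 2 by rewrite sqr_sqrtr.
have a0 : 0 <= a by exact: sqrtr_ge0.
have b0 : 0 <= b by exact: sqrtr_ge0.
set c := \sum_(i <- t) _.
(* This is the sum of the squares of [b * f i - a * g i], expanded; the factor [a * b] is cancelled
   below, and the case where it vanishes is treated apart. *)
have key : 2 * (a * b) * c <= 2 * (a * b) * (a * b).
  have : 0 <= \sum_(i <- t) (b * f i - a * g i) ^+ 2 by exact: sq0.
  have -> : \sum_(i <- t) (b * f i - a * g i) ^+ 2 =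
      b ^+ 2 * a ^+ 2 - 2 * (a * b) * c + a ^+ 2 * b ^+ 2.
    rewrite {1}a2 {2}b2 /c !mulr_sumr -sumrB -big_split /=.
    by apply: eq_bigr => i _; ring.
  by nra.
have [ab0|ab_gt0] := eqVneq (a * b) 0; last first.
  by move: key; rewrite ler_pM2l // mulr_gt0 ?ltr0n // lt_neqAle eq_sym ab_gt0 mulr_ge0.
have zero k : \sum_(i <- t) k i ^+ 2 = 0 :> R -> forall w : I -> R,
    \sum_(i <- t) k i * w i = 0.
  elim: (t) => [|i s IH]; first by move=> _ w; rewrite big_nil.
  rewrite big_cons => /eqP; rewrite paddr_eq0 ?sqr_ge0 ?sumr_ge0 //; last first.
    by move=> j _; exact: sqr_ge0.
  rewrite sqrf_eq0 => /andP[/eqP k0 /eqP s0] w.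
  by rewrite big_cons k0 mul0r add0r IH.
rewrite ab0 /c; move/eqP: ab0; rewrite mulf_eq0 => /orP[]/eqP ab0.
  by rewrite zero // -a2 ab0 expr0n.
under eq_bigr => i _ do rewrite mulrC.
by rewrite zero // -b2 ab0 expr0n.
Qed.

(** The norm of [r] on the residue class of [k]; reducing [k] makes the value at [M] agree with the
    value at [0]. *)
Definition fold_norm r p M k : R :=
  Num.sqrt (\sum_(0 <= i < p) r (k %% M + i * M)%N ^+ 2).

Lemma sum_fold_norm r p M :
  \sum_(0 <= k < M) fold_norm r p M k ^+ 2 = \sum_(0 <= j < p * M) r j ^+ 2.
Proof.
rewrite sum_fold; apply: eq_big_nat => k /andP[_ kM].
by rewrite sqr_sqrtr ?modn_small // sumr_ge0 // => i _; exact: sqr_ge0.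
Qed.

Lemma periodicM (T : Type) (f : nat -> T) M :
  (forall j, f (j + M)%N = f j) -> forall i k, f (k + i * M)%N = f k.
Proof.
move=> fM; elim=> [|i IH] k; first by rewrite addn0.
by rewrite mulSn addnCA addnC fM IH.
Qed.

(* Cauchy-Schwarz on each residue class of edges. *)
Lemma real_form_fold h m r p M : (0 < M)%N ->
  (forall j, h (j + M)%N = h j) -> (forall j, m (j + M)%N = m j) ->
  (forall j, 0 <= m j) -> (forall j, (p * M <= j)%N -> r j = 0) ->
  real_form h m r (p * M) <= real_form h m (fold_norm r p M) M.
Proof.
move=> M_gt0 hM mM m0 r0; rewrite /real_form sum_fold.
apply: ler_sum_nat => k /andP[_ kM].
under eq_bigr => i _ do rewrite -addSn !(periodicM hM, periodicM mM).
have sq0 (f : nat -> R) : 0 <= \sum_(0 <= i < p) f i ^+ 2.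
  by apply: sumr_ge0 => i _; exact: sqr_ge0.
rewrite big_split /= -!mulr_sumr lerD //.
  by rewrite sqr_sqrtr // modn_small.
apply: ler_wpM2l => //; apply: le_trans (sum_mul_le_sqrt _ _ _) _.
rewrite [X in _ <= _ * X]/fold_norm modn_small //.
apply: ler_wpM2r; first exact: sqrtr_ge0.
rewrite ler_wsqrtr //.
have [kM1|] := ltnP k.+1 M; first by rewrite modn_small.
(* The edge leaving [M - 1] wraps around to the class of [0], shifted by one period: the extra last
   term [r (p * M)] is zero, and the missing term [r 0] only enlarges the bound. *)
move=> Mk; have -> : k.+1 = M by apply/eqP; rewrite eqn_leq kM.
rewrite modnn; under eq_bigr => i _ do rewrite -mulSn.
under [leRHS]eq_bigr => i _ do rewrite add0n.
case: p r0 sq0 => [|p] r0 _; first by rewrite !big_geq.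
rewrite [leRHS]big_nat_recl //= big_nat_recr //= r0 // expr0n addr0.
by rewrite lerDr sqr_ge0.
Qed.

Lemma real_form_repeat h m r p M :
  (forall j, h (j + M)%N = h j) -> (forall j, m (j + M)%N = m j) ->
  (forall j, r (j + M)%N = r j) ->
  real_form h m r (p * M) = p%:R * real_form h m r M.
Proof.
move=> hM mM rM; rewrite /real_form sum_fold mulr_sumr.
apply: eq_bigr => k _.
under eq_bigr => i _ do
  rewrite -addSn !(periodicM hM, periodicM mM, periodicM rM).
by rewrite sumr_const_nat subn0 mulr_natl.
Qed.

End Folding.

(** * Support functions of the path and of the cycle *)

Section PeriodicRange.
Variable R : realType.
Implicit Types (b up dn u : nat -> R[i]).

(* Values of the form on finitely supported unit vectors of ell^2. *)
Definition path_range b up dn M : set R[i] :=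
  [set z | exists p u, [/\ forall j, (p * M <= j)%N -> u j = 0,
     \sum_(0 <= j < p * M) normc (u j) ^+ 2 = 1 &
     z = band_form b up dn u (p * M)] ].

(** The condition [u M = u 0] makes the last term of [band_form] the edge from [M - 1] back to
    [0]. *)
Definition cycle_range b up dn M : set R[i] :=
  [set z | exists u, [/\ u M = u 0%N,
     \sum_(0 <= j < M) normc (u j) ^+ 2 = 1 & z = band_form b up dn u M] ].

Variables (M : nat) (b up dn up' dn' : nat -> R[i]).
Hypotheses (M_gt0 : (0 < M)%N).
Hypotheses (bM : forall j, b (j + M)%N = b j) (upM : forall j, up (j + M)%N = up j)
  (dnM : forall j, dn (j + M)%N = dn j).
Hypothesis edge_normE : forall zeta j, (j < M)%N ->
  edge_norm zeta up' dn' j = edge_norm zeta up dn j.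

Let rotM zeta j : rot zeta b (j + M)%N = rot zeta b j.
Proof. by rewrite /rot bM. Qed.

Let edgeM zeta j : edge_norm zeta up dn (j + M)%N = edge_norm zeta up dn j.
Proof. by rewrite /edge_norm /edge upM dnM. Qed.

Let cycle_formE zeta r :
  real_form (rot zeta b) (edge_norm zeta up' dn') r M =
  real_form (rot zeta b) (edge_norm zeta up dn) r M.
Proof. by apply: eq_big_nat => j /andP[_ jM]; rewrite edge_normE. Qed.

(** Passing to moduli and folding can only increase the form, and the folded value is attained on
    the cycle by the gauged vector, which closes up because the total phase is [1]. *)
Lemma path_range_le_cycle (gaugeM : forall zeta, gauge (edge zeta up' dn') M = 1)
    zeta z : path_range b up dn M z ->
  exists2 w, cycle_range b up' dn' M w &
    complex.Re (zeta * z) <= complex.Re (zeta * w).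
Proof.
move=> [p [u [u0 u1 ->]]].
pose s := fold_norm (fun j => normc (u j)) p M.
have s_ge0 j : 0 <= s j by exact: sqrtr_ge0.
pose v j := (s j)%:C * gauge (edge zeta up' dn') j.
exists (band_form b up' dn' v M); last first.
  rewrite Re_band_form_gauge // cycle_formE; apply: le_trans (Re_band_form_le _ _ _ _ _ _) _.
  apply: real_form_fold => // [j|j jp]; first exact: normc_ge0.
  by rewrite u0 // normc0.
exists v; split=> //.
  rewrite /v gaugeM /gauge big_geq //; congr (_%:C * _).
  by rewrite /s /fold_norm modnn mod0n.
rewrite -u1 -sum_fold_norm; apply: eq_bigr => j _.
by rewrite normcM normc_gauge mulr1 normc_real ger0_norm.
Qed.

(* A vector of the cycle is repeated along the path; only the last edge of the
   path is lost, and its weight is negligible after normalisation. *)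
Lemma cycle_range_le_path zeta e z : 0 < e -> cycle_range b up' dn' M z ->
  exists2 w, path_range b up dn M w &
    complex.Re (zeta * z) <= complex.Re (zeta * w) + e.
Proof.
move=> e_gt0 [v [v0 v1 ->]].
pose r j := normc (v (j %% M)%N).
have r_ge0 j : 0 <= r j by exact: normc_ge0.
have rM j : r (j + M)%N = r j by rewrite /r modnDr.
pose E := real_form (rot zeta b) (edge_norm zeta up dn) r M.
have Re_le : complex.Re (zeta * band_form b up' dn' v M) <= E.
  apply: le_trans (Re_band_form_le _ _ _ _ _ _) _.
  rewrite cycle_formE /E le_eqVlt; apply/orP; left; apply/eqP.
  apply: real_form_eq => j; rewrite leq_eqVlt => /orP[/eqP ->|jM].
    by rewrite /r modnn v0.
  by rewrite /r modn_small.
(* The contribution of the single edge cut at the end; with [p] copies and normalisation by [k] its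
   share is [B / p], and [p] is taken large enough to bring it below [e]. *)
pose B := edge_norm zeta up dn M.-1 * (r M * r M.-1).
have B_ge0 : 0 <= B by rewrite !mulr_ge0 // normc_ge0.
have [q qB] : exists q : nat, B / e < q%:R.
  by exists (Num.bound (B / e)); apply: archi_boundP; rewrite divr_ge0 // ltW.
pose p := q.+1; have p_gt0 : 0 < p%:R :> R by rewrite ltr0n.
have pB : B / p%:R <= e.
  rewrite ler_pdivrMr // mulrC -ler_pdivrMr //; apply: ltW (lt_le_trans qB _).
  by rewrite ler_nat.
pose k := (Num.sqrt p%:R)^-1 : R.
have k_ge0 : 0 <= k by rewrite invr_ge0 sqrtr_ge0.
have k2 : k ^+ 2 = p%:R^-1 by rewrite exprVn sqr_sqrtr // ltW.
pose s j := if (j < p * M)%N then k * r j else 0.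
have s_ge0 j : 0 <= s j by rewrite /s; case: ifP => // _; exact: mulr_ge0.
pose u j := (s j)%:C * gauge (edge zeta up dn) j.
exists (band_form b up dn u (p * M)).
  exists p, u; split=> //.
    by move=> j pj; rewrite /u /s ltnNge pj /= mul0r.
  transitivity (\sum_(0 <= j < p * M) k ^+ 2 * r j ^+ 2).
    apply: eq_big_nat => j /andP[_ jp].
    rewrite normcM normc_gauge mulr1 normc_real ger0_norm //.
    by rewrite /s jp exprMn.
  rewrite -mulr_sumr sum_fold.
  under eq_bigr => j _ do under eq_bigr => i _ do rewrite (periodicM rM).
  under eq_bigr => j _ do rewrite sumr_const_nat subn0 -mulr_natl.
  rewrite -mulr_sumr mulrA k2 mulVf ?gt_eqF // mul1r -v1.
  by apply: eq_big_nat => j /andP[_ jM]; rewrite /r modn_small.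
apply: le_trans Re_le _; rewrite Re_band_form_gauge //.
suff -> : real_form (rot zeta b) (edge_norm zeta up dn) s (p * M) =
   k ^+ 2 * (p%:R * E - B).
  rewrite k2 mulrBr mulrA mulVf ?gt_eqF // mul1r mulrC -addrA lerDl addrC.
  by rewrite subr_ge0.
rewrite /E -real_form_repeat //.
have pM : (p * M).-1.+1 = (p * M)%N by rewrite prednK // muln_gt0.
have modM : M.-1.+1 = M by rewrite prednK.
have lastE : (p * M).-1 = (M.-1 + q * M)%N by rewrite /p mulSn -{1}modM addSn.
rewrite /real_form -pM !big_nat_recr //= mulrBr mulrDr mulr_sumr.
rewrite -addrA; congr (_ + _).
  apply: eq_big_nat => j /andP[_ jp].
  have jp1 : (j.+1 < p * M)%N by rewrite -pM ltnS.
  by rewrite /s jp1 (ltn_trans _ jp1) //; ring.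
have -> : s (p * M).-1.+1 = 0 by rewrite /s pM ltnn.
have -> : s (p * M).-1 = k * r (p * M).-1 by rewrite /s -{2}pM leqnn.
rewrite mul0r mulr0 addr0 pM lastE /B /p.
have -> : r (q.+1 * M)%N = r M by rewrite mulSn (periodicM rM).
rewrite !(periodicM (rotM zeta), periodicM (edgeM zeta), periodicM rM).
by ring.
Qed.

End PeriodicRange.

(** * Convexity, boundedness and closedness *)

Section Separation.
Variable R : realType.
Implicit Types (S : set R[i]) (z w p : R[i]).

Definition cconvex S := forall z w (t : R), S z -> S w -> 0 <= t <= 1 ->
  S (z + t%:C * (w - z)).

(* An almost nearest point [w0] of [S] to [p] can be improved by moving towards
   a point of [S] that is almost extremal in the direction of [p - w0]. *)
Lemma support_approx S p (B : R) : S !=set0 -> cconvex S ->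
  (forall z, S z -> normc z <= B) ->
  (forall zeta e, 0 < e -> exists2 w, S w &
     complex.Re (zeta * p) <= complex.Re (zeta * w) + e) ->
  forall e, 0 < e -> exists2 w, S w & normc (p - w) < e.
Proof.
move=> [z0 Sz0] convS boundS supS e e_gt0; apply: contrapT => far.
pose d w := normc (p - w) ^+ 2.
have d_ge w : S w -> e ^+ 2 <= d w.
  move=> Sw; rewrite ler_sqr ?nnegrE ?normc_ge0 ?(ltW e_gt0) //.
  by rewrite leNgt; apply/negP => lt_e; apply: far; exists w.
pose D := inf (d @` S).
have infS : has_inf (d @` S).
  split; first by exists (d z0); exists z0.
  by exists (e ^+ 2) => _ [w Sw <-]; exact: d_ge.
have D_gt0 : 0 < D.
  apply: (@lt_le_trans _ _ (e ^+ 2)); first by rewrite exprn_gt0.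
  by apply: lb_le_inf; [case: infS | move=> _ [w Sw <-]; exact: d_ge].
have D_le w : S w -> D <= d w.
  by move=> Sw; apply: ge_inf; [case: infS | exists w].
(* [4 * B ^+ 2] bounds the squared distance between two points of [S]; the summand [D] keeps [L]
   positive and the step [t] below [1]. *)
pose L := 4 * B ^+ 2 + D.
have L_gt0 : 0 < L by rewrite ltr_wpDl // mulr_ge0 // sqr_ge0.
have [_ [w0 Sw0 <-] dw0] : exists2 x, (d @` S) x & x < D + D ^+ 2 / (4 * L).
  by apply: inf_adherent => //; rewrite divr_gt0 ?exprn_gt0 ?mulr_gt0.
have [w Sw supw] := supS (p - w0)^* (D / 2) (divr_gt0 D_gt0 (ltr0n _ 2)).
(* The minimiser of [- t * D + t ^+ 2 * L]: moving by [t] gains at least [D ^+ 2 / (4 * L)], more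
   than the excess of [d w0] over the infimum [D]. *)
pose t := D / (2 * L).
have t01 : 0 <= t <= 1.
  rewrite divr_ge0 ?mulr_ge0 ?(ltW D_gt0) ?(ltW L_gt0) //=.
  rewrite ler_pdivrMr ?mulr_gt0 // mul1r /L.
  by have := sqr_ge0 B; move: D_gt0; nra.
have := D_le _ (convS _ _ _ Sw0 Sw t01).
have wB := boundS _ Sw; have w0B := boundS _ Sw0.
have wwB : normc (w - w0) ^+ 2 <= L.
  have : normc (w - w0) <= 2 * B.
    apply: le_trans (le_normcD w (- w0)) _.
    by rewrite normcN mulr_natl mulr2n lerD.
  have := normc_ge0 (w - w0); rewrite /L; move: D_gt0; nra.
have dt : d (w0 + t%:C * (w - w0)) =
    d w0 - 2 * t * complex.Re ((p - w0)^* * (w - w0)) + t ^+ 2 * normc (w - w0) ^+ 2.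
  rewrite /d !sqr_normcE; case: (p) (w) (w0) => p1 p2 [w1 w2] [v1 v2] /=.
  ring.
have inner : D / 2 <= complex.Re ((p - w0)^* * (w - w0)).
  have -> : complex.Re ((p - w0)^* * (w - w0)) =
     d w0 + complex.Re ((p - w0)^* * w) - complex.Re ((p - w0)^* * p).
    rewrite /d !sqr_normcE; case: (p) (w) (w0) => p1 p2 [w1 w2] [v1 v2] /=.
    ring.
  by have := D_le _ Sw0; move: supw; lra.
rewrite dt; apply/negP; rewrite -ltNge.
have tL : t * L = D / 2 by rewrite /t; field; rewrite gt_eqF.
have eta : D ^+ 2 / (4 * L) = t * (D / 2) by rewrite /t; field; rewrite gt_eqF.
move/andP: t01 => [t0 t1].
have h1 : t * (D / 2) <= t * complex.Re ((p - w0)^* * (w - w0)) by rewrite ler_wpM2l.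
have h2 : t ^+ 2 * normc (w - w0) ^+ 2 <= t ^+ 2 * L by rewrite ler_wpM2l ?sqr_ge0.
have h3 : t ^+ 2 * L = t * (D / 2) by rewrite expr2 -mulrA tL.
by move: dw0; rewrite eta; lra.
Qed.

End Separation.

Section Polarisation.
Variable R : realType.
Implicit Types (b up dn u v : nat -> R[i]).

Definition band_bil b up dn u v K : R[i] :=
  \sum_(0 <= j < K) (b j * (u j * (v j)^*) + up j * (u j.+1 * (v j)^*)
              + dn j * (u j * (v j.+1)^*)).

Lemma band_form_comb b up dn u v (x y : R[i]) K :
  band_form b up dn (fun j => x * u j + y * v j) K =
  x * x^* * band_form b up dn u K + y * y^* * band_form b up dn v K
  + y * x^* * band_bil b up dn v u K + x * y^* * band_bil b up dn u v K.
Proof.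
rewrite /band_form /band_bil !mulr_sumr -!big_split /=.
by apply: eq_bigr => j _; rewrite !rmorphD !rmorphM /=; ring.
Qed.

Lemma band_form_scale b up dn u (x : R[i]) K :
  band_form b up dn (fun j => x * u j) K = x * x^* * band_form b up dn u K.
Proof.
rewrite /band_form mulr_sumr.
by apply: eq_bigr => j _; rewrite !rmorphM /=; ring.
Qed.

(** The squared norm in the shape of a band form, so that the expansion of a combination applies to
    it too. *)
Definition norm_form u K : R[i] := band_form (fun=> 1) (fun=> 0) (fun=> 0) u K.

Lemma norm_formE u K :
  norm_form u K = (\sum_(0 <= j < K) normc (u j) ^+ 2)%:C.
Proof.
rewrite rmorph_sum; apply: eq_bigr => j _.
by rewrite mul1r !mul0r !addr0 mulcJ.
Qed.

(* For a unimodular [mu] making [mu * c1 + mu^* * c2] real, where [c1] and [c2]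
   are the normalised cross terms, the form is affine-real along the segment from
   [u] to [mu v], and the intermediate value theorem applies (Toeplitz-Hausdorff). *)
Lemma cycle_range_convex b up dn M : cconvex (cycle_range b up dn M).
Proof.
move=> z w t [u [u0 u1 zE]] [v [v0 v1 wE]] /andP[t_ge0 t_le1].
have [<-|zw] := eqVneq z w.
  by exists u; rewrite subrr mulr0 addr0.
have wz : w - z != 0 by rewrite subr_eq0 eq_sym.
pose cross b' up' dn' mu := mu * band_bil b' up' dn' v u M +
    mu^* * band_bil b' up' dn' u v M : R[i].
(* Subtracting [z] times the norm form and dividing by [w - z] sends the two values to [0] and [1];
   [c mu] is what this leaves of the cross terms. *)
pose c mu := (cross b up dn mu
   - z * cross (fun=> 1) (fun=> 0) (fun=> 0) mu) / (w - z).
pose c1 := (band_bil b up dn v u M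
   - z * band_bil (fun=> 1) (fun=> 0) (fun=> 0) v u M) / (w - z).
pose c2 := (band_bil b up dn u v M
   - z * band_bil (fun=> 1) (fun=> 0) (fun=> 0) u v M) / (w - z).
pose mu := (phase (c1 - c2^*))^*.
have mu1 : mu * mu^* = 1 by rewrite /mu conjCK mulrC phase_unit.
have cE : c mu = mu * c1 + mu^* * c2.
  by rewrite /c /cross /c1 /c2 !mulrA -mulrDl; congr (_ / _); ring.
have cIm : complex.Im (c mu) = 0.
  have -> : complex.Im (c mu) = complex.Im ((c1 - c2^*) * mu).
    rewrite cE; case: (mu) (c1) (c2) => m1 m2 [x1 x2] [y1 y2] /=; ring.
  by rewrite mul_phase.
pose g := complex.Re (c mu).
have cg : c mu = g%:C by rewrite [LHS]complexE cIm /= mulr0 addr0.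
pose nu := complex.Re (cross (fun=> 1) (fun=> 0) (fun=> 0) mu).
pose f s j := (1 - s)%:C * u j + (s%:C * mu) * v j : R[i].
have normE s : \sum_(0 <= j < M) normc (f s j) ^+ 2 =
    (1 - s) ^+ 2 + s ^+ 2 + s * (1 - s) * nu.
  rewrite -[LHS]/(complex.Re (_%:C)) -norm_formE /norm_form band_form_comb.
  have := norm_formE u M; rewrite /norm_form u1 => ->.
  have := norm_formE v M; rewrite /norm_form v1 => ->.
  rewrite [s * _ * nu]mulrC; transitivity (complex.Re (((1 - s) ^+ 2 + s ^+ 2)%:C
      + (s * (1 - s))%:C * cross (fun=> 1) (fun=> 0) (fun=> 0) mu)); last first.
    by rewrite ReD Re_realM /= [_ * nu]mulrC.
  congr complex.Re; rewrite /cross !rmorphM /= !conjC_real.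
  have := mu1; move: (mu^*) => m' m1.
  rewrite !(rmorphD, rmorphXn, rmorphM, rmorphB, rmorph1) /=.
  by ring: m1.
have formE s : band_form b up dn (f s) M =
    z * (\sum_(0 <= j < M) normc (f s j) ^+ 2)%:C
    + (s ^+ 2 + s * (1 - s) * g)%:C * (w - z).
  rewrite real_complexD [(_ * g)%:C]real_complexM -cg /c mulrDl.
  rewrite -[X in _ + (_ + X)]mulrA [_ / _ * _]divfK //.
  rewrite -norm_formE /norm_form !band_form_comb.
  have := norm_formE u M; rewrite /norm_form u1 => ->.
  have := norm_formE v M; rewrite /norm_form v1 => ->.
  rewrite !rmorphM /= !conjC_real -zE -wE /cross.
  have := mu1; move: (mu^*) => m' m1.
  rewrite !(rmorphD, rmorphXn, rmorphM, rmorphB, rmorph1) /=.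
  by ring: m1.
(* A root is a parameter at which the normalised form is [t] times the squared norm. The values at
   [0] and [1] are [- t] and [1 - t]. *)
pose P : {poly R} := 'X ^+ 2 + g *: ('X * (1 - 'X))
   - t *: ((1 - 'X) ^+ 2 + 'X ^+ 2 + nu *: ('X * (1 - 'X))).
have PE s : P.[s] = s ^+ 2 + s * (1 - s) * g
    - t * ((1 - s) ^+ 2 + s ^+ 2 + s * (1 - s) * nu).
  by rewrite /P !hornerE /=; ring.
have [s /andP[s0 s1] /rootP] : exists2 s, 0 <= s <= 1 & root P s.
  apply: poly_ivt => //; rewrite !PE.
  by move: t_ge0 t_le1; rewrite !expr0n !expr1n /=; lra.
rewrite PE -normE => /eqP; rewrite subr_eq0 => /eqP root_s.
set n := \sum_(_ <= _ < _) _ in root_s.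
have n_ge0 : 0 <= n by apply: sumr_ge0 => j _; exact: sqr_ge0.
(* If the combination vanished, [u] and [v] would be proportional and [z] would equal [w]. *)
have n_neq0 : n != 0.
  apply/eqP => n0.
  have f0 j : (j < M)%N -> f s j = 0.
    move=> jM; apply: eq0_normc; apply/eqP; rewrite -sqrf_eq0; apply/eqP.
    move: n0; rewrite /n big_mkord => n0.
    have sq0 (i : 'I_M) : true -> 0 <= normc (f s i) ^+ 2 by rewrite sqr_ge0.
    exact: (psumr_eq0P sq0 n0 (i := Ordinal jM)).
  have M_gt0 : (0 < M)%N.
    by case: (M) u1 => // /eqP; rewrite big_geq // eq_sym oner_eq0.
  have uv j : (j <= M)%N -> (1 - s)%:C * u j = - (s%:C * mu) * v j.
    rewrite mulNr => jM; apply/eqP; rewrite -subr_eq0 opprK; apply/eqP.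
    move: jM; rewrite leq_eqVlt => /orP[/eqP ->|]; last exact: f0.
    by rewrite u0 v0; exact: f0.
  have uvE b' up' dn' : ((1 - s) ^+ 2)%:C * band_form b' up' dn' u M =
      (s ^+ 2)%:C * band_form b' up' dn' v M.
    transitivity (band_form b' up' dn' (fun j => (1 - s)%:C * u j) M).
      by rewrite band_form_scale conjC_real -real_complexM.
    rewrite (band_form_eq _ _ _ uv) band_form_scale; congr (_ * _).
    rewrite rmorphN rmorphM /= conjC_real mulrNN mulrACA mu1 mulr1.
    by rewrite -real_complexM.
  have := uvE (fun=> 1) (fun=> 0) (fun=> 0).
  have := norm_formE u M; rewrite /norm_form u1 => ->.
  have := norm_formE v M; rewrite /norm_form v1 => ->.
  rewrite !mulr1 => /complexI s2.
  have := uvE b up dn; rewrite -zE -wE s2 => /mulfI zwE.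
  case/eqP: zw; apply: zwE; rewrite eq_complex /= eqxx andbT.
  rewrite sqrf_eq0; apply/eqP => s_eq0.
  by move/eqP: s2; rewrite s_eq0 subr0 expr1n expr0n oner_eq0.
have n_gt0 : 0 < n by rewrite lt_neqAle eq_sym n_neq0.
pose k := (Num.sqrt n)^-1.
have k2 : k ^+ 2 * n = 1 by rewrite exprVn sqr_sqrtr // mulVf.
exists (fun j => k%:C * f s j); split.
- by rewrite /f u0 v0.
- rewrite -[RHS]k2 /n mulr_sumr; apply: eq_bigr => j _.
  by rewrite normcM normc_real exprMn real_normK ?num_real.
- rewrite band_form_scale formE root_s -/n conjC_real -expr2 -rmorphXn /=.
  have : (k ^+ 2)%:C * n%:C = 1 :> R[i] by rewrite -rmorphM /= k2.
  rewrite [(t * n)%:C]real_complexM; move: (k ^+ 2)%:C n%:C => k' n' kn.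
  by ring: kn.
Qed.

End Polarisation.

Section RangeProperties.
Variable R : realType.
Implicit Types (b up dn u v : nat -> R[i]).

Lemma band_form_zero b up dn u K L : (K <= L)%N ->
  (forall j, (K <= j)%N -> u j = 0) ->
  band_form b up dn u L = band_form b up dn u K.
Proof.
move=> KL u0; rewrite /band_form (big_cat_nat (leq0n K) KL) //=.
rewrite [X in _ + X]big1_seq ?addr0 // => j; rewrite mem_index_iota => /andP[_ /andP[Kj _]].
by rewrite !u0 ?(leqW Kj) // !(mul0r, mulr0, addr0).
Qed.

Lemma band_form_shift b up dn u K L :
  (forall j, b (j + K)%N = b j) -> (forall j, up (j + K)%N = up j) ->
  (forall j, dn (j + K)%N = dn j) -> (forall j, (j < K)%N -> u j = 0) ->
  band_form b up dn u (K + L) = band_form b up dn (fun j => u (j + K)%N) L.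
Proof.
move=> bK upK dnK u0.
rewrite /band_form (big_cat_nat (leq0n K) (leq_addr L K)) //= big_nat big1 ?add0r; last first.
  by move=> j /andP[_ jK]; rewrite (u0 j) // rmorph0 !(mul0r, mulr0, addr0).
rewrite -{1}[K]add0n big_addn addKn; apply: eq_bigr => j _.
by rewrite bK upK dnK.
Qed.

Definition ccontinuous (T : topologicalType) (f : T -> R[i]) :=
  continuous (fun x => complex.Re (f x)) /\ continuous (fun x => complex.Im (f x)).

Section ComplexContinuity.
Variable T : topologicalType.
Implicit Types f g : T -> R[i].

Lemma ccontinuous_cst (z : R[i]) : ccontinuous (fun _ : T => z).
Proof. by split; exact: cst_continuous. Qed.

Lemma ccontinuousD f g :
  ccontinuous f -> ccontinuous g -> ccontinuous (fun x => f x + g x).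
Proof.
move=> [f1 f2] [g1 g2]; split.
  rewrite (_ : (fun x => _) = fun x => complex.Re (f x) + complex.Re (g x)).
    by move=> x; apply: cvgD; [exact: f1|exact: g1].
  by apply/funext => x; case: (f x); case: (g x).
rewrite (_ : (fun x => _) = fun x => complex.Im (f x) + complex.Im (g x)).
  by move=> x; apply: cvgD; [exact: f2|exact: g2].
by apply/funext => x; case: (f x); case: (g x).
Qed.

Lemma ccontinuousM f g :
  ccontinuous f -> ccontinuous g -> ccontinuous (fun x => f x * g x).
Proof.
move=> [f1 f2] [g1 g2]; split.
  rewrite (_ : (fun x => _) = fun x => complex.Re (f x) * complex.Re (g x)
      - complex.Im (f x) * complex.Im (g x)).
    by move=> x; apply: cvgB; apply: cvgM;
      [exact: f1|exact: g1|exact: f2|exact: g2].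
  by apply/funext => x; case: (f x); case: (g x).
rewrite (_ : (fun x => _) = fun x => complex.Re (f x) * complex.Im (g x)
    + complex.Im (f x) * complex.Re (g x)).
  by move=> x; apply: cvgD; apply: cvgM;
    [exact: f1|exact: g2|exact: f2|exact: g1].
by apply/funext => x; case: (f x); case: (g x).
Qed.

Lemma ccontinuousJ f : ccontinuous f -> ccontinuous (fun x => (f x)^*).
Proof.
move=> [f1 f2]; split.
  by rewrite (_ : (fun x => _) = fun x => complex.Re (f x)) //;
    apply/funext => x; case: (f x).
rewrite (_ : (fun x => _) = fun x => - complex.Im (f x)).
  by move=> x; apply: cvgN; exact: f2.
by apply/funext => x; case: (f x).
Qed.

Lemma ccontinuous_sum (I : Type) (s : seq I) (F : I -> T -> R[i]) :
  (forall i, ccontinuous (F i)) ->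
  ccontinuous (fun x => \sum_(i <- s) F i x).
Proof.
move=> F_cont; elim: s => [|i s IH].
  rewrite (_ : (fun x => _) = fun=> 0); first exact: ccontinuous_cst.
  by apply/funext => x; rewrite big_nil.
rewrite (_ : (fun x => _) = fun x => F i x + \sum_(j <- s) F j x).
  exact: ccontinuousD.
by apply/funext => x; rewrite big_cons.
Qed.

End ComplexContinuity.

Variables (b up dn : nat -> R[i]) (M : nat).
Hypothesis M_gt0 : (0 < M)%N.

(** Translation by whole periods preserves the form, so [v] can be moved beyond the support of [u];
    combining with weights [sqrt (1 - t)] and [sqrt t] then produces no cross terms. *)
Lemma path_range_convex :
  (forall j, b (j + M)%N = b j) -> (forall j, up (j + M)%N = up j) ->
  (forall j, dn (j + M)%N = dn j) -> cconvex (path_range b up dn M).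
Proof.
move=> bM upM dnM z w t [p [u [u0 u1 ->]]] [q [v [v0 v1 ->]]] /andP[t0 t1].
(* One empty period is left between the supports, so that no edge joins them. *)
pose K := (p.+1 * M)%N.
pose v' j := if (j < K)%N then 0 else v (j - K)%N.
pose x : R := Num.sqrt (1 - t); pose y : R := Num.sqrt t.
have x2 : x%:C * (x%:C)^* = (1 - t)%:C.
  by rewrite conjC_real -real_complexM -expr2 sqr_sqrtr ?subr_ge0.
have y2 : y%:C * (y%:C)^* = t%:C.
  by rewrite conjC_real -real_complexM -expr2 sqr_sqrtr.
have pK : (p * M < K)%N by rewrite /K mulSn -[ltnLHS]add0n ltn_add2r.
have lenE : ((p.+1 + q) * M = K + q * M)%N by rewrite mulnDl.
have combE b' up' dn' : (forall j, b' (j + M)%N = b' j) ->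
    (forall j, up' (j + M)%N = up' j) -> (forall j, dn' (j + M)%N = dn' j) ->
  band_form b' up' dn' (fun j => x%:C * u j + y%:C * v' j) ((p.+1 + q) * M) =
  (1 - t)%:C * band_form b' up' dn' u (p * M) + t%:C * band_form b' up' dn' v (q * M).
  move=> b'M up'M dn'M; rewrite band_form_comb x2 y2 lenE.
  have disj j k : (k <= j.+1)%N -> (j <= k.+1)%N -> u j * (v' k)^* = 0 /\ v' k * (u j)^* = 0.
    move=> kj jk; rewrite /v'; have [kK|Kk] := ltnP k K.
      by rewrite rmorph0 mulr0 mul0r.
    by rewrite u0 ?rmorph0 ?mulr0 ?mul0r //; apply: leq_trans (_ : K.-1 <= _)%N; lia.
  rewrite [band_bil _ _ _ u v' _]big1 => [|j _]; last first.
    have [e _] := disj j j (leqnSn _) (leqnSn _).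
    have [e1 _] := disj j.+1 j (leqW (leqnSn _)) (leqnn _).
    have [e2 _] := disj j j.+1 (leqnn _) (leqW (leqnSn _)).
    by rewrite e e1 e2 !mulr0 !addr0.
  rewrite [band_bil _ _ _ v' u _]big1 => [|j _]; last first.
    have [_ e] := disj j j (leqnSn _) (leqnSn _).
    have [_ e1] := disj j.+1 j (leqW (leqnSn _)) (leqnn _).
    have [_ e2] := disj j j.+1 (leqnn _) (leqW (leqnSn _)).
    by rewrite e e1 e2 !mulr0 !addr0.
  rewrite !mulr0 !addr0 (band_form_zero _ _ _ _ u0); last by rewrite -lenE leq_mul2r; lia.
  congr (_ + _ * _); rewrite band_form_shift; first last.
  - by move=> j jK; rewrite /v' jK.
  - exact: periodicM.
  - exact: periodicM.
  - exact: periodicM.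
  by apply: band_form_eq => j _; rewrite /v' ltnNge leq_addl /= addnK.
exists (p.+1 + q)%N, (fun j => x%:C * u j + y%:C * v' j); split.
- move=> j; rewrite lenE => Kj; rewrite /v' ltnNge (leq_trans (leq_addr _ _) Kj) /=.
  rewrite u0 ?v0 ?mulr0 ?addr0 //; first by rewrite leq_subRL ?(leq_trans (leq_addr _ _) Kj).
  exact: leq_trans (ltnW pK) (leq_trans (leq_addr _ _) Kj).
- apply: complexI; rewrite -norm_formE /norm_form combE //.
  have := norm_formE u (p * M); rewrite /norm_form u1 => ->.
  have := norm_formE v (q * M); rewrite /norm_form v1 => ->.
  by rewrite -!real_complexM -real_complexD !mulr1 subrK.
- rewrite combE // rmorphB rmorph1 /=; ring.
Qed.

Lemma path_range_neq0 : path_range b up dn M !=set0.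
Proof.
pose u j : R[i] := if j is 0 then 1 else 0.
exists (band_form b up dn u (1 * M)), 1%N, u; split=> //.
  by rewrite mul1n /u => j; case: j => // /(leq_trans M_gt0).
rewrite mul1n -(prednK M_gt0) big_nat_recl // normc1 expr1n.
by rewrite big1 ?addr0 // => j _; rewrite normc0 expr0n.
Qed.

Lemma normc_sum (I : Type) (s : seq I) (F : I -> R[i]) :
  normc (\sum_(i <- s) F i) <= \sum_(i <- s) normc (F i).
Proof.
elim: s => [|i s IH]; first by rewrite !big_nil normc0.
by rewrite !big_cons (le_trans (le_normcD _ _)) // lerD2l.
Qed.

Lemma cycle_range_bounded : exists B : R,
  forall z, cycle_range b up dn M z -> normc z <= B.
Proof.
exists (\sum_(0 <= j < M) (normc (b j) + normc (up j) + normc (dn j))).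
move=> _ [u [u0 u1 ->]].
have u_le1 j : (j <= M)%N -> normc (u j) <= 1.
  have lt1 k : (k < M)%N -> normc (u k) <= 1.
    move=> kM; rewrite -(@ler_pXn2r _ 2) ?nnegrE ?normc_ge0 // expr1n -u1.
    rewrite big_mkord (bigD1 (Ordinal kM)) //= lerDl.
    by apply: sumr_ge0 => i _; exact: sqr_ge0.
  rewrite leq_eqVlt => /orP[/eqP ->|]; last exact: lt1.
  by rewrite u0; exact: lt1.
apply: le_trans (normc_sum _ _) _; apply: ler_sum_nat => j /andP[_ jM].
have uu k l : (k <= M)%N -> (l <= M)%N -> normc (u k * (u l)^*) <= 1.
  by move=> kM lM; rewrite normcM normc_conj mulr_ile1 ?normc_ge0 ?u_le1.
have le1 (x y : R[i]) : normc y <= 1 -> normc (x * y) <= normc x.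
  by move=> y1; rewrite normcM ler_piMr ?normc_ge0.
do 2 (apply: le_trans (le_normcD _ _) _; apply: lerD; last by
  apply: le1; apply: uu => //; exact: ltnW).
by apply: le1; apply: uu; exact: ltnW.
Qed.

(** The distance to [p] is continuous on the compact unit sphere, hence attains its minimum; points
    of the range arbitrarily near [p] force this minimum to be zero. *)
Lemma cycle_range_closed p :
  (forall e, 0 < e -> exists2 w, cycle_range b up dn M w & normc (p - w) < e) ->
  cycle_range b up dn M p.
Proof.
move=> approx.
pose T := 'rV[R]_(M + M).
pose ent (x : T) j : R := if insub j is Some i then x 0 i else 0.
(* Real parts occupy the first [M] coordinates and imaginary parts the last [M]; the reduction
   modulo [M] closes the cycle. *)
pose u (x : T) j : R[i] := Complex (ent x (j %% M)%N) (ent x (j %% M + M)%N).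
pose N (x : T) : R := \sum_(0 <= j < M) normc (u x j) ^+ 2.
pose S := [set x : T | N x = 1].
have ent_cont j : continuous (fun x : T => ent x j).
  rewrite /ent; case: insubP => [i _ _|_]; last exact: cst_continuous.
  exact: coord_continuous.
have u_cont j : ccontinuous (fun x => u x j) by split; exact: ent_cont.
have form_cont b' up' dn' : ccontinuous (fun x => band_form b' up' dn' (u x) M).
  apply: ccontinuous_sum => j; apply: ccontinuousD.
    apply: ccontinuousD; apply: ccontinuousM; try exact: ccontinuous_cst;
    by apply: ccontinuousM => //; exact: ccontinuousJ.
  apply: ccontinuousM; first exact: ccontinuous_cst.
  by apply: ccontinuousM => //; exact: ccontinuousJ.
have N_cont : continuous N.
  have [h _] := form_cont (fun=> 1) (fun=> 0) (fun=> 0).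
  have NE y : complex.Re (band_form (fun=> 1) (fun=> 0) (fun=> 0) (u y) M) = N y.
    by have := norm_formE (u y) M; rewrite /norm_form => ->.
  rewrite (_ : N = fun y => complex.Re
    (band_form (fun=> 1) (fun=> 0) (fun=> 0) (u y) M)) //.
  by apply/funext => y; rewrite NE.
pose D x : R := normc (p - band_form b up dn (u x) M) ^+ 2.
have D_cont : continuous D.
  have [h1 h2] : ccontinuous (fun x => p - band_form b up dn (u x) M).
    rewrite (_ : (fun x => _) = fun x => p + (-1) * band_form b up dn (u x) M).
      by apply: ccontinuousD; [|apply: ccontinuousM] => //; exact: ccontinuous_cst.
    by apply/funext => x; rewrite mulN1r.
  rewrite (_ : D = fun x => complex.Re (p - band_form b up dn (u x) M) *
      complex.Re (p - band_form b up dn (u x) M) +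
      complex.Im (p - band_form b up dn (u x) M) *
      complex.Im (p - band_form b up dn (u x) M)); last first.
    by apply/funext => x; rewrite /D sqr_normcE !expr2.
  by move=> x; exact: (cvgD (cvgM (h1 x) (h1 x)) (cvgM (h2 x) (h2 x))).
have S_compact : compact S.
  apply: bounded_closed_compact.
    exists 1; split; first exact: num_real.
    move=> B B1 x Sx; apply: le_trans (ltW B1).
    rewrite -[`|x|]/(mx_norm x).
    have [->|/mx_norm_neq0[[i k] /= xE]] := eqVneq (mx_norm x) 0; first exact: ler01.
    rewrite xE (ord1 i) -(@ler_pXn2r _ 2) ?nnegrE // expr1n.
    rewrite real_normK ?num_real // -Sx.
    have le_N j : (j < M)%N -> normc (u x j) ^+ 2 <= N x.
      move=> jM; rewrite /N big_mkord (bigD1 (Ordinal jM)) //= lerDl.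
      by apply: sumr_ge0 => l _; exact: sqr_ge0.
    have [kM|Mk] := ltnP k M.
      apply: le_trans (le_N k kM); rewrite sqr_normcE /= /ent modn_small //.
      by rewrite valK lerDl sqr_ge0.
    have kM : (k - M < M)%N by rewrite ltn_subLR.
    apply: le_trans (le_N _ kM); rewrite sqr_normcE /= /ent modn_small //.
    by rewrite subnK // valK lerDr sqr_ge0.
  exact: (iffLR (continuous_closedP N) N_cont [set 1] (@closed_eq R 1)).
have cycleE x : S x -> cycle_range b up dn M (band_form b up dn (u x) M).
  by move=> Sx; exists (u x); split=> //; rewrite /u modnn mod0n.
have cycleI w : cycle_range b up dn M w -> exists2 x, S x & w = band_form b up dn (u x) M.
  move=> [v [v0 v1 ->]].
  pose x : T := \row_i (if (i < M)%N then complex.Re (v i) else complex.Im (v (i - M)%N)).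
  have xE j : (j < M)%N -> u x j = v j.
    move=> jM; rewrite /u /ent modn_small //.
    have j1 : (j < M + M)%N by rewrite ltn_addr.
    have j2 : (j + M < M + M)%N by rewrite ltn_add2r.
    rewrite (insubT (fun k => (k < M + M)%N) j1) (insubT (fun k => (k < M + M)%N) j2).
    by rewrite !mxE /= jM ltnNge leq_addl /= addnK; case: (v j).
  have uxM : u x M = u x 0%N by rewrite /u modnn mod0n.
  exists x; first by rewrite /S /= -[RHS]v1; apply: eq_big_nat => j /andP[_ jM]; rewrite xE.
  apply: band_form_eq => j; rewrite leq_eqVlt => /orP[/eqP ->|jM]; last by rewrite xE.
  by rewrite uxM xE.
have S0 : S !=set0.
  by have [w /cycleI[x Sx _] _] := approx 1 ltr01; exists x.
have Dwithin : {within S, continuous D} by exact: continuous_subspaceT.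
have [x /set_mem Sx Dmin] := compact_EVT_min S0 S_compact Dwithin.
have [Dx0|Dx] := eqVneq (normc (p - band_form b up dn (u x) M)) 0.
  move/eq0_normc/eqP: Dx0; rewrite subr_eq0 => /eqP ->; exact: cycleE.
have D_gt0 : 0 < normc (p - band_form b up dn (u x) M).
  by rewrite lt_neqAle eq_sym Dx normc_ge0.
have [w /cycleI[y Sy ->]] := approx _ D_gt0.
rewrite ltNge -(@ler_pXn2r _ 2) ?nnegrE ?normc_ge0 //.
by rewrite (Dmin y (mem_set Sy)).
Qed.

End RangeProperties.

(** * The cycle range as the closure of the path range *)

Section RangeComparison.
Variables (R : realType) (M : nat) (b up dn up' dn' : nat -> R[i]).
Hypotheses (M_gt0 : (0 < M)%N).
Hypotheses (bM : forall j, b (j + M)%N = b j) (upM : forall j, up (j + M)%N = up j)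
  (dnM : forall j, dn (j + M)%N = dn j).
Hypothesis edge_normE : forall zeta j, (j < M)%N ->
  edge_norm zeta up' dn' j = edge_norm zeta up dn j.
Hypothesis gaugeM : forall zeta, gauge (edge zeta up' dn') M = 1.

(** In the direction [(phase z)^*] the real part is [normc z], so the comparison of support
    functions carries over the bound for the cycle. *)
Lemma path_range_bounded : exists B : R,
  forall z, path_range b up dn M z -> normc z <= B.
Proof.
have [B cycB] := cycle_range_bounded b up' dn' M_gt0; exists B => z Pz.
have [w Cw] := path_range_le_cycle M_gt0 bM upM dnM edge_normE gaugeM (phase z)^* Pz.
rewrite mulrC mul_phase /= => /le_trans; apply; apply: le_trans (Re_le_normc _) _.
rewrite normcM normc_conj; have : normc (phase z) = 1.
  apply/eqP; rewrite -(eqrXn2 (ltn0Sn 1)) ?normc_ge0 // expr1n.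
  by have := phase_unit z; rewrite mulcJ => /complexI ->.
by move=> ->; rewrite mul1r cycB.
Qed.

(** Both ranges are convex and bounded with the same support function, so each lies in the closure
    of the other; the cycle range is closed. *)
Lemma cycle_range_approx z : cycle_range b up' dn' M z <->
  forall e, 0 < e -> exists2 w, path_range b up dn M w & normc (z - w) < e.
Proof.
split=> [Cz | approx].
  have [B pathB] := path_range_bounded.
  apply: (support_approx (path_range_neq0 _ _ _ M_gt0) (path_range_convex M_gt0 bM upM dnM) pathB).
  move=> zeta e e_gt0.
  exact: (cycle_range_le_path M_gt0 bM upM dnM edge_normE zeta e_gt0 Cz).
have [B cycB] := cycle_range_bounded b up' dn' M_gt0.
apply: (cycle_range_closed M_gt0).
apply: (support_approx _ (@cycle_range_convex _ _ _ _ _) cycB).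
  have [w Pw] := path_range_neq0 b up dn M_gt0.
  by have [w' Cw' _] := path_range_le_cycle M_gt0 bM upM dnM edge_normE gaugeM 1 Pw; exists w'.
move=> zeta e e_gt0.
have n_gt0 : 0 < normc zeta + 1 by rewrite ltr_wpDl ?normc_ge0.
have [w Pw zw] := approx _ (divr_gt0 e_gt0 n_gt0).
have [w' Cw' ww'] := path_range_le_cycle M_gt0 bM upM dnM edge_normE gaugeM zeta Pw.
exists w' => //; rewrite addrC -lerBlDr (le_trans (lerB (lexx _) ww')) //.
have -> : complex.Re (zeta * z) - complex.Re (zeta * w) = complex.Re (zeta * (z - w)).
  by case: (zeta) (z) (w) => a1 a2 [b1 b2] [c1 c2] /=; ring.
apply: le_trans (Re_le_normc _) _; rewrite normcM.
have := ltW zw; rewrite ler_pdivlMr // mulrDr mulr1 mulrC.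
by have := normc_ge0 (z - w); lra.
Qed.

End RangeComparison.

(** * Limits and closures in [R[i]] through real radii *)

Section ComplexLimits.
Variable R : realType.
Implicit Types (z l : R[i]).

Lemma gt0_complexP (e : R[i]) : 0 < e -> exists2 r : R, 0 < r & e = r%:C.
Proof. by case: e => x y; rewrite ltcE /= => /andP[/eqP -> x0]; exists x. Qed.

Lemma complex_cvgP (T : Type) (F : set_system T) (FF : Filter F) (f : T -> R[i]) l :
  (f : T -> R[i]^o) @ F --> (l : R[i]^o) <->
  forall e : R, 0 < e -> \forall t \near F, normc (l - f t) < e.
Proof.
rewrite cvgrPdist_lt; split=> cvf e e_gt0.
  have e0 : 0 < e%:C :> R[i] by rewrite ltcR.
  by apply: filterS (cvf _ e0) => t; rewrite ltcR.
have [r r_gt0 ->] := gt0_complexP e_gt0.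
by apply: filterS (cvf _ r_gt0) => t; rewrite -ltcR.
Qed.

Lemma closure_complexP (S : set R[i]) z :
  closure (S : set R[i]^o) z <->
  forall e : R, 0 < e -> exists2 w, S w & normc (z - w) < e.
Proof.
split=> [clz e e_gt0 | approx B /nbhs_ballP[e e_gt0 zeB]].
  have e0 : 0 < e%:C :> R[i] by rewrite ltcR.
  have [w [Sw zw]] := clz _ (nbhsx_ballx (z : R[i]^o) _ e0).
  by exists w => //; move: zw; rewrite -ball_normE /ball_ /= ltcR.
have [r r_gt0 eE] := gt0_complexP e_gt0.
have [w Sw zw] := approx _ r_gt0.
exists w; split=> //; apply: zeB.
by rewrite -ball_normE /ball_ /= eE ltcR.
Qed.

Lemma normc_le_ReIm z : normc z <= `|complex.Re z| + `|complex.Im z|.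
Proof.
rewrite {1}[z]complexE; apply: le_trans (le_normcD _ _) _.
by rewrite normcM !normc_real [normc 'i%C]/= expr0n expr1n add0r sqrtr1 mul1r.
Qed.

Lemma series_normc_cvg (g : nat -> R[i]) (v : nat -> R) :
  (forall j, normc (g j) <= v j) -> cvgn (series v) ->
  exists l, series (g : nat -> R[i]^o) @ \oo --> (l : R[i]^o).
Proof.
move=> gv cv.
have v_ge0 j : 0 <= v j by exact: le_trans (normc_ge0 _) (gv j).
have dom (f : nat -> R) : (forall j, `|f j| <= normc (g j)) -> cvgn (series f).
  move=> fg; apply: normed_cvg; apply: series_le_cvg cv => // [j|j].
    exact: normr_ge0.
  exact: le_trans (fg j) (gv j).
have /cvg_ex[x cx] : cvgn (series (fun j => complex.Re (g j))).
  apply: dom => j; case: (g j) => p q /=.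
  by rewrite -sqrtr_sqr ler_wsqrtr // lerDl sqr_ge0.
have /cvg_ex[y cy] : cvgn (series (fun j => complex.Im (g j))).
  apply: dom => j; case: (g j) => p q /=.
  by rewrite -sqrtr_sqr ler_wsqrtr // lerDr sqr_ge0.
exists (Complex x y); apply/complex_cvgP => e e_gt0.
have e2 : 0 < e / 2 by rewrite divr_gt0.
move/cvgrPdist_lt/(_ _ e2): cx => cx; move/cvgrPdist_lt/(_ _ e2): cy => cy.
near=> n; apply: le_lt_trans (normc_le_ReIm _) _; rewrite (splitr e) ltrD //.
  rewrite (_ : complex.Re _ = x - series (fun j => complex.Re (g j)) n).
    by near: n.
  by rewrite /series /= -Re_sum; case: (\sum_(_ <= _ < _) _).
rewrite (_ : complex.Im _ = y - series (fun j => complex.Im (g j)) n).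
  by near: n.
have -> : series (fun j => complex.Im (g j)) n = complex.Im (series (g : nat -> R[i]^o) n).
  by rewrite /series /= (big_morph (@complex.Im R) (id1 := 0) (op1 := +%R)) // => -[? ?] [].
by case: (series _ n).
Unshelve. all: by end_near. Qed.

End ComplexLimits.

(** * The numerical range on ell^2 and finitely supported vectors *)

Section EllTwo.
Variables (R : realType) (a b c : nat -> R[i]).
Implicit Types u : nat -> R[i].

Let dn j := a j.+1.

Lemma tridiag_opE u j :
  tridiag_op a b c u j = b j * u j + c j * u j.+1
    + (if j is k.+1 then a j * u k else 0).
Proof.
rewrite /tridiag_op !big_ord_recr /= {1 3}/tridiag_entry.
case: j => [|j].
  by rewrite big_ord0 /= add0r addr0.
rewrite big_ord_recr /= big1 ?add0r => [|i _]; last first.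
  rewrite /tridiag_entry /=; do 3 (case: eqP => [?|_]; first by have := ltn_ord i; lia).
  by rewrite mul0r.
have e1 : (j == j.+1) = false by rewrite ltn_eqF.
have e2 : (j == j.+2) = false by rewrite ltn_eqF // ltnW.
have e3 : (j.+1 == j) = false by rewrite gtn_eqF.
rewrite /tridiag_entry /= !eqSS !eqxx e1 e2 e3.
by rewrite [RHS]addrC addrA.
Qed.

(** The entry [dn n] sits in row [n + 1] of the operator but belongs to edge [n] of the form, so the
    first [n + 1] rows miss it. *)
Lemma sum_tridiag_op u n :
  \sum_(0 <= j < n.+1) tridiag_op a b c u j * (u j)^* =
  band_form b c dn u n.+1 - dn n * (u n * (u n.+1)^*).
Proof.
elim: n => [|n IH]; rewrite /band_form.
  by rewrite !big_nat1 tridiag_opE; ring.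
rewrite big_nat_recr //= IH [in RHS]big_nat_recr //= /band_form tridiag_opE.
by rewrite /dn; ring.
Qed.

Lemma finite_series_cvg (K : numDomainType) (V : pseudoMetricNormedZmodType K)
    (g : nat -> V) n :
  (forall j, (n <= j)%N -> g j = 0) -> series g @ \oo --> \sum_(0 <= j < n) g j.
Proof.
move=> g0; apply: cvg_near_cst; exists n => // k /= nk.
rewrite /series /= (big_cat_nat (leq0n n) nk) /= [X in _ + X]big1_seq ?addr0 //.
by move=> j; rewrite mem_index_iota => /andP[_ /andP[nj _]]; exact: g0.
Qed.

Lemma ell2_dotE (u v : nat -> R[i]) (l : R[i]) :
  series ((fun j => u j * (v j)^*) : nat -> R[i]^o) @ \oo --> (l : R[i]^o) ->
  ell2_dot u v = l.
Proof.
move=> ul; rewrite /ell2_dot.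
exact: (cvg_lim (@norm_hausdorff _ R[i]^o) ul).
Qed.

Lemma path_range_ell2 M z : path_range b c dn M z -> numrange_ell2 (tridiag_op a b c) z.
Proof.
move=> [p [u [u0 u1 ->]]]; set K := (p * M)%N in u0 u1 *.
exists u; last first.
  rewrite (ell2_dotE (finite_series_cvg (n := K.+1) _)).
    rewrite [LHS]sum_tridiag_op (u0 K) // mul0r mulr0 subr0.
    exact: band_form_zero.
  by move=> j Kj; rewrite u0 ?rmorph0 ?mulr0 // ltnW.
split.
  apply/cvg_ex; exists (\sum_(0 <= j < K) normc (u j) ^+ 2).
  by apply: finite_series_cvg => j Kj; rewrite u0 // normc0 expr0n.
rewrite (ell2_dotE (finite_series_cvg (n := K) _)).
  under eq_bigr => j _ do rewrite mulcJ.
  by rewrite -rmorph_sum /= u1 rmorph1 sqrtC1.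
by move=> j Kj; rewrite u0 // mul0r.
Qed.

Lemma series_shift_cvg (f : nat -> R) :
  cvgn (series f) -> cvgn (series (fun j => f j.+1)).
Proof.
move=> /cvg_ex[l fl]; apply/cvg_ex; exists (l - f 0%N).
have -> : series (fun j => f j.+1) = fun n => series f n.+1 - f 0%N.
  apply/funext => n; rewrite /series /= big_nat_recl //.
  by rewrite addrC addKr.
by apply: cvgB; [rewrite cvg_shiftS | exact: cvg_cst].
Qed.

(** A unit vector is truncated at a large multiple of the period and renormalised. *)
Lemma numrange_ell2_approx M B z : (0 < M)%N ->
  (forall j, b (j + M)%N = b j) -> (forall j, c (j + M)%N = c j) ->
  (forall j, dn (j + M)%N = dn j) ->
  (forall w, path_range b c dn M w -> normc w <= B) ->
  numrange_ell2 (tridiag_op a b c) z ->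
  forall e, 0 < e -> exists2 w, path_range b c dn M w & normc (z - w) < e.
Proof.
move=> M_gt0 bM cM dnM pathB [u [u2 u1] <-].
pose r j := normc (u j).
have [C0 [bC cC dC]] : exists C0 : R, [/\ forall j, normc (b j) <= C0,
    forall j, normc (c j) <= C0 & forall j, normc (dn j) <= C0].
  pose s := \sum_(0 <= j < M) (normc (b j) + normc (c j) + normc (dn j)).
  have le_s j : normc (b (j %% M)%N) + normc (c (j %% M)%N) + normc (dn (j %% M)%N) <= s.
    have jM : (j %% M < M)%N by rewrite ltn_mod.
    rewrite /s big_mkord (bigD1 (Ordinal jM)) //= lerDl.
    by apply: sumr_ge0 => i _; rewrite !addr_ge0 ?normc_ge0.
  have red (f : nat -> R[i]) : (forall j, f (j + M)%N = f j) ->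
      forall j, f j = f (j %% M)%N.
    by move=> fM j; rewrite {1}(divn_eq j M) addnC (periodicM fM).
  exists s; split=> j; rewrite (red _ bM, red _ cM, red _ dnM);
    apply: le_trans (le_s j); have := normc_ge0 (b (j %% M)%N);
    have := normc_ge0 (c (j %% M)%N); have := normc_ge0 (dn (j %% M)%N); lra.
have C0_ge0 : 0 <= C0 := le_trans (normc_ge0 _) (bC 0%N).
have r0 j : 0 <= r j by exact: normc_ge0.
(* A summable majorant of the terms of the form and of each cross term alone; as it tends to zero,
   edges cut far out are negligible. *)
pose v j := C0 * (2 * r j ^+ 2 + r j.+1 ^+ 2).
have cv : cvgn (series v).
  rewrite (_ : v = C0 *: (2 *: (fun j => r j ^+ 2) + (fun j => r j.+1 ^+ 2))) //.
  apply: is_cvg_seriesZ; apply: is_cvg_seriesD; first exact: is_cvg_seriesZ.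
  exact: series_shift_cvg u2.
have v0 : v @ \oo --> 0 := cvg_series_cvg_0 cv.
pose g j := b j * (u j * (u j)^*) + c j * (u j.+1 * (u j)^*) + dn j * (u j * (u j.+1)^*).
have edge_le (x : R[i]) j : normc x <= C0 ->
    normc (x * (u j.+1 * (u j)^*)) <= C0 * (r j.+1 * r j).
  by move=> xC; rewrite !normcM normc_conj ler_wpM2r ?mulr_ge0 ?normc_ge0 //.
have cross_le j : r j.+1 * r j <= (r j ^+ 2 + r j.+1 ^+ 2) / 2.
  have := sqr_ge0 (r j - r j.+1); rewrite sqrrB; lra.
have down_le j : normc (dn j * (u j * (u j.+1)^*)) <= C0 * (r j.+1 * r j).
  rewrite !normcM normc_conj mulrC [normc (u j) * _]mulrC mulrC.
  by rewrite ler_wpM2r ?mulr_ge0 ?normc_ge0 //.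
have gv j : normc (g j) <= v j.
  apply: le_trans (le_normcD _ _) _; apply: le_trans (lerD (le_normcD _ _) (lexx _)) _.
  have h1 : normc (b j * (u j * (u j)^*)) <= C0 * r j ^+ 2.
    by rewrite !normcM normc_conj -expr2 ler_wpM2r // sqr_ge0.
  have h2 := edge_le _ j (cC j); have h3 := down_le j.
  have h4 : C0 * (r j.+1 * r j) <= C0 * ((r j ^+ 2 + r j.+1 ^+ 2) / 2) by rewrite ler_wpM2l.
  by rewrite /v; lra.
have [W cW] := series_normc_cvg gv cv.
have bd_le j : normc (c j * (u j.+1 * (u j)^*)) <= v j /\
               normc (dn j * (u j * (u j.+1)^*)) <= v j.
  have h : C0 * (r j.+1 * r j) <= v j.
    rewrite ler_wpM2l //; apply: le_trans (cross_le j) _.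
    by have := sqr_ge0 (r j); have := sqr_ge0 (r j.+1); lra.
  by split; [exact: le_trans (edge_le _ _ (cC j)) h | exact: le_trans (down_le j) h].
have cWS : (series (g : nat -> R[i]^o) n.+1) @[n --> \oo] --> (W : R[i]^o).
  by rewrite (cvg_shiftS (series (g : nat -> R[i]^o))).
have dotW : ell2_dot (tridiag_op a b c u) u = W.
  apply: ell2_dotE.
  rewrite -(cvg_shiftS (series ((fun j => tridiag_op a b c u j * (u j)^*) : nat -> R[i]^o))).
  apply/complex_cvgP => e e_gt0.
  have e2 : 0 < e / 2 by rewrite divr_gt0.
  move/complex_cvgP/(_ _ e2): cWS => near1.
  move/cvgr0_norm_lt/(_ _ e2): v0 => near2.
  near=> n.
  rewrite /series /= sum_tridiag_op.
  rewrite (_ : W - _ = (W - series (g : nat -> R[i]^o) n.+1)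
    + dn n * (u n * (u n.+1)^*)); last by rewrite opprB addrCA addrC.
  rewrite (splitr e); apply: le_lt_trans (le_normcD _ _) _; apply: ltrD.
    by near: n.
  apply: le_lt_trans (bd_le n).2 _; apply: le_lt_trans (ler_norm _) _.
  by near: n.
have [l cl] : exists l, series (fun j => r j ^+ 2) @ \oo --> (l : R).
  by case/cvg_ex: u2 => l; exists l.
have dotl : ell2_dot u u = l%:C.
  apply: ell2_dotE; apply/complex_cvgP => e e_gt0.
  apply: filterS (iffLR (cvgrPdist_lt _ _) cl _ e_gt0) => n; apply: le_lt_trans.
  rewrite /series /=; under eq_bigr => j _ do rewrite mulcJ.
  by rewrite -rmorph_sum -rmorphB normc_real.
have l1 : l = 1.
  by apply: complexI; rewrite -dotl -[LHS]sqrtCK u1 expr1n.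
rewrite {}l1 in cl; rewrite {}dotW => e e_gt0.
have B1 : 0 < `|B| + 1 by rewrite ltr_wpDl.
have e4 : 0 < e / 4 by rewrite divr_gt0.
(* The bound [1] keeps the truncated vector nonzero; the other bound controls the error of
   renormalisation. *)
have d_gt0 : 0 < Num.min 1 (e / 4 / (`|B| + 1)) by rewrite lt_min ltr01 divr_gt0.
have clS : (series (fun j => r j ^+ 2) n.+1) @[n --> \oo] --> (1 : R).
  by rewrite (cvg_shiftS (series (fun j => r j ^+ 2))).
move/complex_cvgP/(_ _ e4): cWS => near1.
move/cvgr0_norm_lt/(_ _ e4): v0 => near2.
move/cvgrPdist_lt/(_ _ d_gt0): clS => near3.
have [N _ nearN] := filterI near1 (filterI near2 near3).
pose K := (N.+1 * M)%N; pose n := K.-1.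
have nK : n.+1 = K by rewrite /n prednK // muln_gt0 M_gt0.
have Nn : (N <= n)%N by rewrite -ltnS nK /K; apply: leq_pmulr.
have [n1 [n2]] := nearN n Nn; rewrite nK lt_min => /andP[n3 n4].
set S := series (fun j => r j ^+ 2) K in n3 n4.
have S_gt0 : 0 < S by move: n3; rewrite ltr_distlC; lra.
pose u' j := if (j < K)%N then u j else 0.
pose k := (Num.sqrt S)^-1.
have k2 : k ^+ 2 = S^-1 by rewrite exprVn sqr_sqrtr // ltW.
pose w := band_form b c dn (fun j => k%:C * u' j) K.
have truncE : band_form b c dn u' K =
    series (g : nat -> R[i]^o) n.+1 - c n * (u n.+1 * (u n)^*)
      - dn n * (u n * (u n.+1)^*).
  rewrite /band_form /series /= -nK !big_nat_recr //= /u' -nK ltnn leqnn rmorph0.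
  rewrite (eq_big_nat _ _ (F2 := g)) => [|j /andP[_ jn]]; first by rewrite /g; ring.
  by rewrite !ltnS jn (ltnW jn).
have Pw : path_range b c dn M w.
  exists N.+1, (fun j => k%:C * u' j); split=> //.
    by move=> j Kj; rewrite /u' ltnNge Kj /= mulr0.
  transitivity (\sum_(0 <= j < K) k ^+ 2 * r j ^+ 2).
    apply: eq_big_nat => j /andP[_ jK]; rewrite /u' jK normcM normc_real exprMn.
    by rewrite real_normK ?num_real.
  by rewrite -mulr_sumr k2 mulVf // gt_eqF.
exists w => //.
have wE : band_form b c dn u' K = S%:C * w.
  rewrite /w band_form_scale conjC_real -real_complexM -expr2 k2 mulrA -real_complexM.
  by rewrite mulfV ?gt_eqF // mul1r.
(* Four errors below [e / 4]: the tail of the series, the two cross terms of the cut edge, and the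
   renormalisation. *)
have -> : W - w = (W - series (g : nat -> R[i]^o) n.+1)
    + (c n * (u n.+1 * (u n)^*) + dn n * (u n * (u n.+1)^*)) + (S - 1)%:C * w.
  have -> : (S - 1)%:C * w = band_form b c dn u' K - w.
    by rewrite wE rmorphB mulrBl rmorph1 mul1r.
  by rewrite truncE; ring.
have h1 : normc ((S - 1)%:C * w) < e / 4.
  rewrite normcM normc_real distrC.
  apply: (@le_lt_trans _ _ (`|1 - S| * (`|B| + 1))).
    rewrite ler_wpM2l //; apply: le_trans (pathB _ Pw) _.
    by rewrite (le_trans (ler_norm _)) // lerDl.
  by rewrite -ltr_pdivlMr.
have [h2 h3] := bd_le n; have h4 := ler_norm (v n).
apply: le_lt_trans (le_normcD _ _) _.
have h5 := le_normcD (W - series (g : nat -> R[i]^o) n.+1)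
  (c n * (u n.+1 * (u n)^*) + dn n * (u n * (u n.+1)^*)).
have h6 := le_normcD (c n * (u n.+1 * (u n)^*)) (dn n * (u n * (u n.+1)^*)).
by lra.
Unshelve. all: by end_near. Qed.

End EllTwo.

(** * The matrix of the cycle *)

Section CycleMatrix.
Variable F : comNzRingType.
Implicit Types b up dn : nat -> F.

(** Contributions are added rather than selected by cases, so the quadratic form is that of the
    cycle even when [M] is so small that positions coincide. *)
Definition cycle_mx b up dn M : 'M[F]_M :=
  \matrix_(i, j) (b i *+ (i == j :> nat) + up i *+ (j == (i.+1 %% M)%N :> nat)
                  + dn j *+ (i == (j.+1 %% M)%N :> nat)).

Lemma cycle_mxE b up dn k :
  cycle_mx b up dn k.+3 =
  tridiag_mx b up dn k.+3 + dn k.+2 *: delta_mx ord0 ord_max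
  + up k.+2 *: delta_mx ord_max ord0.
Proof.
have modS i : (i < k.+3)%N -> (i.+1 %% k.+3 = if i == k.+2 then 0 else i.+1)%N.
  by rewrite ltnS leq_eqVlt; case: eqP => [-> _|_ /= ik]; rewrite ?modnn ?modn_small.
apply/matrixP => -[i iM] [j jM]; rewrite !mxE -!(inj_eq val_inj) /= !modS //.
have [->|ik] := eqVneq i k.+2; have [->|jk] := eqVneq j k.+2.
- by rewrite /= !mulr0n !mulr0 mulr1n !addr0.
- rewrite (ltn_eqF jM) mulr0n add0r mulr0 addr0 /=.
  have [->|_] := eqVneq j 0%N; first by rewrite /= !mulr0n mulr1n mulr1 addr0 add0r.
  by case: (_ == _); rewrite ?mulr0n ?mulr1n ?mulr0 ?addr0 ?add0r.
- rewrite (negPf ik) (ltn_eqF iM) mulr0n add0r mulr0 addr0 andbT.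
  have [->|_] := eqVneq i 0%N; first by rewrite /= !mulr0n mulr1n mulr1 add0r.
  by case: (_ == _); rewrite ?mulr0n ?mulr1n ?mulr0 ?addr0 ?add0r.
- rewrite andbF !mulr0 !addr0.
  have [->|_] := eqVneq i j; first by rewrite (ltn_eqF (leqnn _)) !mulr0n mulr1n !addr0.
  have [->|_] := eqVneq j i.+1; first by rewrite (ltn_eqF (leqW (leqnn _))) !mulr0n mulr1n addr0 add0r.
  by case: (_ == _); rewrite !mulr0n ?mulr1n ?addr0 ?add0r.
Qed.

Lemma det_cycle_mx b up dn k :
  \det (cycle_mx b up dn k.+3) =
  continuant b (fun i => up i * dn i) 0 k.+3
  - up k.+2 * dn k.+2 * continuant b (fun i => up i * dn i) 1 k.+1
  + (-1) ^+ k.+2 * (\prod_(i < k.+3) dn i + \prod_(i < k.+3) up i).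
Proof.
rewrite cycle_mxE det_cyclic_tridiag_mx; congr (_ + _ * (_ + _)).
  by rewrite [RHS]big_ord_recr mulrC.
by rewrite [RHS]big_ord_recr mulrC.
Qed.

End CycleMatrix.

Section CycleRange.
Variables (R : realType) (M : nat) (b up dn : nat -> R[i]).
Hypothesis M_gt0 : (0 < M)%N.

Lemma cvec_dot_sum (x y : 'cV[R[i]]_M) :
  cvec_dot x y = \sum_i (y i 0)^* * x i 0.
Proof. by rewrite /cvec_dot mxE; apply: eq_bigr => i _; rewrite !mxE. Qed.

Lemma cycle_mx_form (x : 'cV[R[i]]_M) (u : nat -> R[i]) :
  (forall i : 'I_M, u i = x i 0) -> u M = u 0%N ->
  cvec_dot (cycle_mx b up dn M *m x) x = band_form b up dn u M.
Proof.
move=> ux uM; rewrite cvec_dot_sum.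
have uS (i : 'I_M) : u i.+1 = x (ordS i) 0.
  rewrite -ux /=; have := ltn_ord i; rewrite leq_eqVlt => /orP[/eqP iM|iM].
    by rewrite iM modnn uM.
  by rewrite modn_small.
transitivity (\sum_(i < M) \sum_(j < M) (x i 0)^* * (b i *+ (i == j) + up i *+ (j == ordS i)
    + dn j *+ (i == ordS j)) * x j 0).
  apply: eq_bigr => i _; rewrite mxE mulr_sumr; apply: eq_bigr => j _.
  by rewrite mxE mulrA.
transitivity (\sum_(i < M) \sum_(j < M) (x i 0)^* * (b i *+ (i == j) + up i *+ (j == ordS i)) * x j 0
   + \sum_(j < M) \sum_(i < M) (x i 0)^* * (dn j *+ (i == ordS j)) * x j 0).
  rewrite [X in _ = _ + X]exchange_big -big_split; apply: eq_bigr => i _ /=.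
  by rewrite -big_split; apply: eq_bigr => j _ /=; rewrite -mulrDl -mulrDr.
rewrite /band_form big_mkord -big_split; apply: eq_bigr => i _ /=.
rewrite [X in _ + X](bigD1 (ordS i)) //= eqxx mulr1n [X in _ + (_ + X)]big1 ?addr0; last first.
  by move=> j /negPf ->; rewrite mulr0n mulr0 mul0r.
rewrite [X in X + _](_ : _ = (x i 0)^* * b i * x i 0 + (x i 0)^* * up i * x (ordS i) 0).
  by rewrite uS ux; ring.
transitivity (\sum_(j < M) ((x i 0)^* * b i * x j 0 *+ (i == j) + (x i 0)^* * up i * x j 0 *+ (j == ordS i))).
  apply: eq_bigr => j _.
  by case: (i == j); case: (j == _); rewrite ?mulr1n ?mulr0n ?addr0 ?add0r ?mulr0 ?mul0r ?mulrDr ?mulrDl.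
rewrite big_split /=; congr (_ + _).
  rewrite (bigD1 i) //= eqxx mulr1n big1 ?addr0 // => j.
  by rewrite eq_sym => /negPf ->.
by rewrite (bigD1 (ordS i)) //= eqxx mulr1n big1 ?addr0 // => j /negPf ->.
Qed.

Lemma cvec_dot_normE (x : 'cV[R[i]]_M) (u : nat -> R[i]) :
  (forall i : 'I_M, u i = x i 0) ->
  cvec_dot x x = (\sum_(0 <= j < M) normc (u j) ^+ 2)%:C.
Proof.
move=> ux; rewrite cvec_dot_sum big_mkord rmorph_sum; apply: eq_bigr => i _.
by rewrite mulrC mulcJ ux.
Qed.

Lemma numrange_cycle_mx : numrange_mx (cycle_mx b up dn M) = cycle_range b up dn M.
Proof.
apply/seteqP; split=> [_ [x [_ x1] <-]|_ [u [u0 u1 ->]]].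
  pose u j := x (Ordinal (ltn_pmod j M_gt0)) 0.
  have ux (i : 'I_M) : u i = x i 0.
    by rewrite /u; congr (x _ 0); apply/val_inj; rewrite /= modn_small.
  have uM : u M = u 0%N.
    by rewrite /u; congr (x _ 0); apply/val_inj; rewrite /= modnn mod0n.
  exists u; split=> //; last exact: cycle_mx_form.
  by apply: complexI; rewrite -(cvec_dot_normE ux) -[LHS]sqrtCK x1 expr1n.
pose x : 'cV[R[i]]_M := \col_i u i.
have ux (i : 'I_M) : u i = x i 0 by rewrite mxE.
exists x; last exact: cycle_mx_form.
by split=> //; rewrite (cvec_dot_normE ux) u1 sqrtC1.
Qed.

End CycleRange.

(** * The pencil of a cycle matrix *)

Section Kippenhahn.
Variable R : realType.
Implicit Types (t x y : R) (u v : R[i]).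

(** The entry of [x Re(A) + y Im(A)] at a place where [A] has [u] and its transpose has [v]. *)
Definition pencil_edge x y u v : R[i] :=
  x%:C * ((u + v^*) / 2) + y%:C * ((u - v^*) / (2 * 'i)).

Definition pencil_diag t x y u : R[i] := t%:C + pencil_edge x y u u.

Lemma pencil_edge_conj x y u v : (pencil_edge x y u v)^* = pencil_edge x y v u.
Proof.
rewrite /pencil_edge rmorphD !rmorphM !fmorphV !rmorphM rmorphD rmorphB /=.
rewrite !conjC_real !conjCK conjCi rmorph_nat mulrN invrN.
by ring.
Qed.

Lemma kippenhahn_cycle_mx b up dn M t x y :
  kippenhahn (cycle_mx b up dn M) t x y =
  \det (cycle_mx (fun j => pencil_diag t x y (b j))
    (fun j => pencil_edge x y (up j) (dn j))
    (fun j => pencil_edge x y (dn j) (up j)) M).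
Proof.
rewrite /kippenhahn; congr (\det _); apply/matrixP => i j.
rewrite !mxE -!(inj_eq val_inj) !rmorphD !rmorphMn /= /pencil_diag /pencil_edge.
have [<-|ij] := eqVneq (i : nat) j.
  by rewrite !mulr1n; case: (_ == _); rewrite ?mulr1n ?mulr0n; ring.
rewrite !mulr0n.
by case: (_ == _); case: (_ == _); rewrite ?mulr1n ?mulr0n; ring.
Qed.

End Kippenhahn.

(** * The doubled cycle of a periodic operator *)

Section PeriodicTridiagonal.
Variables (R : realType) (m : nat) (a b c : nat -> R[i]).
Local Notation N := m.+2.
Hypotheses (aN : forall j, a (j + N)%N = a j) (bN : forall j, b (j + N)%N = b j)
  (cN : forall j, c (j + N)%N = c j).

Let dn j := a j.+1.

(* Along the second half of the cycle of length [2N] the two entries of every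
   edge are exchanged; this conjugates the edges of the pencil, so their product
   around the cycle is nonnegative in every direction. *)
Definition cycle_up j := if (j < N)%N then c j else dn j.
Definition cycle_dn j := if (j < N)%N then dn j else c j.

Definition tridiag_cycle_mx M : 'M[R[i]]_M := cycle_mx b cycle_up cycle_dn M.

Let dnN j : dn (j + N)%N = dn j.
Proof. by rewrite /dn -addSn aN. Qed.

Let periodic2 (f : nat -> R[i]) : (forall j, f (j + N)%N = f j) ->
  forall j, f (j + (N + N))%N = f j.
Proof. by move=> fN j; rewrite addnA !fN. Qed.

Lemma edge_conj (zeta u v : R[i]) : (zeta * u + (zeta * v)^*)^* = zeta * v + (zeta * u)^*.
Proof. by rewrite rmorphD /= conjCK addrC. Qed.

(** Exchanging the entries of an edge conjugates it, which keeps its modulus and makes the phases of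
    the two halves cancel; this is what the comparison of path and cycle requires. *)
Lemma closure_numrange_tridiag :
  closure (numrange_ell2 (tridiag_op a b c) : set R[i]^o) =
  numrange_mx (tridiag_cycle_mx (N + N)).
Proof.
have M_gt0 : (0 < N + N)%N by [].
have edge_normE zeta j : (j < N + N)%N ->
    edge_norm zeta cycle_up cycle_dn j = edge_norm zeta c dn j.
  move=> _; rewrite /edge_norm /edge /cycle_up /cycle_dn; case: ifP => // _.
  by rewrite -normc_conj edge_conj.
have gaugeM zeta : gauge (edge zeta cycle_up cycle_dn) (N + N) = 1.
  apply: gauge_double => k kN; rewrite /edge /cycle_up /cycle_dn kN ltnNge leq_addr /=.
  by rewrite edge_conj addnC dnN cN.
have b2 := periodic2 bN; have c2 := periodic2 cN; have d2 := periodic2 dnN.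
have [B pathB] := path_range_bounded M_gt0 b2 c2 d2 edge_normE gaugeM.
rewrite /tridiag_cycle_mx numrange_cycle_mx //; apply/seteqP; split=> z.
  move/closure_complexP => clz.
  apply/(cycle_range_approx M_gt0 b2 c2 d2 edge_normE gaugeM) => e e_gt0.
  have e2 : 0 < e / 2 by rewrite divr_gt0.
  have [w Tw zw] := clz _ e2.
  have [w' Pw' ww'] := numrange_ell2_approx M_gt0 b2 c2 d2 pathB Tw e2.
  exists w' => //; rewrite -(subrKA w) (splitr e).
  by apply: le_lt_trans (le_normcD _ _) _; exact: ltrD.
move/(cycle_range_approx M_gt0 b2 c2 d2 edge_normE gaugeM) => approx.
apply/closure_complexP => e e_gt0; have [w Pw zw] := approx e e_gt0.
by exists w => //; exact: path_range_ell2 Pw.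
Qed.

Variables t x y : R.

Let U j := pencil_edge x y (c j) (dn j).
Let D j := pencil_edge x y (dn j) (c j).
Let d j := pencil_diag t x y (b j).
Let w j := U j * D j.

(** At the last index [alpha_coef] and [gamma_coef] exchange the roles of [a] and [c], whence [D];
    there [a 0] is [dn m.+1] by periodicity. *)
Lemma coef_edge j : (j < N)%N ->
  alpha_coef m.+1 a c j * x%:C + gamma_coef m.+1 a c j * y%:C =
  if (j < m.+1)%N then U j else D j.
Proof.
move=> jN; rewrite /alpha_coef /gamma_coef; case: ifP => [_|/negbT].
  by rewrite /U /pencil_edge mulrC [_ * y%:C]mulrC.
rewrite -leqNgt => mj; have -> : j = m.+1 by apply/eqP; rewrite eqn_leq mj -ltnS jN.
have -> : a 0%N = dn m.+1 by rewrite /dn -[m.+2]add0n aN.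
by rewrite /D /pencil_edge mulrC [_ * y%:C]mulrC.
Qed.

Lemma sqr_norm_coef j : (j < N)%N ->
  `|alpha_coef m.+1 a c j * x%:C + gamma_coef m.+1 a c j * y%:C| ^+ 2 = w j.
Proof.
move=> jN; rewrite coef_edge // normCK /w /U /D.
by case: ifP => _; rewrite pencil_edge_conj // mulrC.
Qed.

Lemma lambda_entryE i j : (i < N)%N -> (j < N)%N ->
  lambda_entry m.+1 a b c t x y i j =
  if i == j then d i else if j == i.+1 then U i else if i == j.+1 then D j else 0.
Proof.
move=> iN jN; rewrite /lambda_entry; case: eqP => [_|_].
  by rewrite /d /pencil_diag /pencil_edge ReE ImE invfM invCi; ring.
case: eqP => [ji|_].
  by rewrite coef_edge // -ltnS -ji jN.
case: eqP => [ij|_] //.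
rewrite -[x%:C in LHS]conjC_real -[y%:C in LHS]conjC_real -!rmorphM -rmorphD /=.
by rewrite coef_edge // -ltnS -ij iN /U pencil_edge_conj.
Qed.

Lemma G_polyE : G_poly m.+1 a b c t x y = continuant d w 0 N.
Proof.
rewrite -[w]/(fun j => U j * D j) -det_tridiag_mx /G_poly; congr (\det _).
by apply/matrixP => i j; rewrite !mxE lambda_entryE // !addn0.
Qed.

Lemma H_polyE : H_poly m.+1 a b c t x y = continuant d w 1 m.
Proof.
rewrite -[w]/(fun j => U j * D j) -det_tridiag_mx /H_poly; congr (\det _).
apply/matrixP => i j; have iN := ltn_ord i; have jN := ltn_ord j.
by rewrite !mxE lambda_entryE ?ltnS 1?ltnW // !addn1 !eqSS.
Qed.

(** The exchange leaves every product [w j] unchanged, so [continuant_double] applies and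
    contributes [- 2] times the product of the [w j]. Around the cycle the upper edges multiply to
    the same product, and so do the lower ones, giving another [- 2]. *)
Lemma kippenhahn_tridiag_cycle_mx :
  kippenhahn (tridiag_cycle_mx (N + N)) t x y =
  (continuant d w 0 N - w m.+1 * continuant d w 1 m) ^+ 2
  - 4 * \prod_(j < N) w j.
Proof.
rewrite /tridiag_cycle_mx kippenhahn_cycle_mx.
pose U' j := pencil_edge x y (cycle_up j) (cycle_dn j).
pose D' j := pencil_edge x y (cycle_dn j) (cycle_up j).
have UD j : U' j * D' j = w j.
  by rewrite /U' /D' /w /cycle_up /cycle_dn; case: ifP => // _; rewrite mulrC.
have wN j : w (j + N)%N = w j by rewrite /w /U /D cN dnN.
have dN j : d (j + N)%N = d j by rewrite /d bN.
have MN : (N + N = (m.+1 + m).+3)%N by rewrite !addnS.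
have prodE (f g f' : nat -> R[i]) : (forall j, f' j = if (j < N)%N then f j else g j) ->
    (forall j, g (j + N)%N = g j) ->
    \prod_(j < N + N) f' j = \prod_(j < N) (f j * g j).
  move=> f'E gN; rewrite big_split_ord big_split /=; congr (_ * _).
    by apply: eq_bigr => i _; rewrite f'E ltn_ord.
  by apply: eq_bigr => i _; rewrite f'E ltnNge leq_addr /= addnC gN.
have prodU : \prod_(j < N + N) U' j = \prod_(j < N) w j.
  apply: (prodE U D) => j; last by rewrite /D dnN cN.
  by rewrite /U' /cycle_up /cycle_dn; case: ifP.
have prodD : \prod_(j < N + N) D' j = \prod_(j < N) w j.
  rewrite (prodE D U) => [|j|j]; first by apply: eq_bigr => i _; rewrite mulrC.
    by rewrite /D' /cycle_up /cycle_dn; case: ifP.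
  by rewrite /U dnN cN.
have := continuant_double dN wN.
move: prodU prodD; rewrite MN => prodU prodD dbl.
rewrite det_cycle_mx prodU prodD.
have -> : (fun j => U' j * D' j) = w by apply/funext.
rewrite UD (_ : w (m.+1 + m).+2 = w m.+1); last by rewrite -(wN m.+1) !addnS.
rewrite [(m.+1 + m.+1)%N]addnS in dbl; rewrite dbl.
(* The cycle has even length, so going once around it is an odd permutation. *)
rewrite (_ : (-1) ^+ _ = -1); first by ring.
by rewrite exprS -addnS addnn -mul2n exprM sqrrN !expr1n mulr1.
Qed.

End PeriodicTridiagonal.

Unset Implicit Arguments.

Theorem theorem2p7 (R : realType) (n : nat) (n_gt0 : (0 < n)%N)
  (a b c : nat -> R[i])
  (a_periodic : forall j : nat, a (j + n.+1)%N = a j)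
  (b_periodic : forall j : nat, b (j + n.+1)%N = b j)
  (c_periodic : forall j : nat, c (j + n.+1)%N = c j) :
  exists A : 'M[R[i]]_(2 * n.+1),
    closure (numrange_ell2 (tridiag_op a b c) : set R[i]^o) = numrange_mx A /\
    forall t x y : R,
      kippenhahn A t x y =
        (G_poly n a b c t x y
         - `|alpha_coef n a c n * x%:C + gamma_coef n a c n * y%:C| ^+ 2
           * H_poly n a b c t x y) ^+ 2
        - 4 * \prod_(j < n.+1)
                `|alpha_coef n a c j * x%:C + gamma_coef n a c j * y%:C| ^+ 2.
Proof.
rewrite mul2n -addnn; case: n n_gt0 a_periodic b_periodic c_periodic => // m _ aN bN cN.
exists (tridiag_cycle_mx m a b c (m.+2 + m.+2)); split.
  exact: closure_numrange_tridiag.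
move=> t x y; rewrite kippenhahn_tridiag_cycle_mx // G_polyE // H_polyE //.
rewrite sqr_norm_coef //; congr (_ - _ * _).
by apply: eq_bigr => j _; rewrite sqr_norm_coef.
Qed.
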